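(* Let $M=\begin{pmatrix}A&B\\0&C\end{pmatrix}$, the Black--Scholes solution $u$ with linear boundary condition, the truncation error part $\delta_h^L$, the $\theta$-method approximations $U_n$ with $\theta\in[\tfrac12,1]$, and the space-time discretization error $\widehat\varepsilon_n=u_h(t_n)-U_n$ be as described in the context. Let $p=1$ if $\tfrac12<\theta\le1$ and $p=2$ if $\theta=\tfrac12$. Assume that all partial derivatives of $u$ of orders $\le p+2$ exist and are continuous on $[0,S]\times[0,T]$. Let $h^\ast>0$ be given and let $$\kappa=4\sigma^2S^3+6rS^2h^\ast,\qquad \eta(t)=\max\{|u_{sss}(\xi,t)|: S-h^\ast\le\xi\le S\}.$$ Assume that $rI+A$ is invertible, $\mu_\infty[rI+A]\le0$, $r+\alpha_m+|\beta_m|+|\gamma_m|\le0$, and that $K$ is a real constant such that $\|\varphi(\Delta t\,A)^n\|_\infty\le K$ whenever $\Delta t=T/N$, $0\le n\le N$, $N\ge1$, where $\varphi(z)=\frac{1+(1-\theta)z}{1-\theta z}$. Then there exists a real constant $c$, depending only on $u$, $S$, $\theta$ and $K$, such that $$|\widehat\varepsilon_n|_\infty\le t_n\cdot\left\{K\cdot\max_{0\le\vartheta\le t_n}|\delta_h^L(\vartheta)|_\infty+(K+\tfrac12)\,\kappa\cdot\max_{0\le\vartheta\le t_n}\eta(\vartheta)+c\cdot(\Delta t)^p\right\}$$ whenever $0<h_{m+2}\le h^\ast$, $\Delta t=T/N$, $1\le n\le N$, $N\ge1$.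
   Context: Let $m\ge 2$ be an integer, let $r>0$, $\sigma\ge 0$, $S>0$, $T>0$ be real, and let $0=s_0<s_1<\dots<s_{m+1}<s_{m+2}=S$ be a (possibly non-uniform) grid with mesh widths $h_j=s_j-s_{j-1}$. $A$ is the real $m\times m$ tridiagonal matrix with diagonal entries $\alpha_1,\dots,\alpha_m$, subdiagonal entries $\beta_2,\dots,\beta_m$ ($\beta_i$ in position $(i,i-1)$) and superdiagonal entries $\gamma_1,\dots,\gamma_{m-1}$ ($\gamma_i$ in position $(i,i+1)$), all given real numbers. $B$ is the real $m\times 2$ matrix whose only possibly nonzero entry is a given real number $\gamma_m$ in position $(m,1)$. $C=\frac{r}{h_{m+2}}\begin{pmatrix}-S & s_{m+1}\\ -S& s_{m+1}\end{pmatrix}$, and $M=\begin{pmatrix}A&B\\0&C\end{pmatrix}$. $u$ is the exact solution on $[0,S]\times[0,T]$ of the Black--Scholes equation $$u_t=\tfrac12\sigma^2s^2u_{ss}+rs\,u_s-ru\qquad(0<s\le S,\ 0<t\le T)$$ with a given initial function $u(\cdot,0)$, a given Dirichlet condition at $s=0$, and the linear boundary condition $u_{ss}(S,t)=0$ for $0<t\le T$. The semidiscrete system is $U'(t)=MU(t)+b(t)$ ($0<t\le T$), $U(0)=U_0$, where $U_0=(u(s_1,0),\dots,u(s_{m+2},0))^{\rm T}$ and $b:[0,T]\to\mathbb{R}^{m+2}$ is a given continuous function coming from the Dirichlet condition at $s=0$; only its first component may be nonzero. Put $u_h(t)=(u(s_1,t),\dots,u(s_{m+2},t))^{\rm T}$.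 The spatial truncation error is $\delta_h(t)=u_h'(t)-Mu_h(t)-b(t)$, partitioned as $\delta_h(t)=\begin{pmatrix}\delta_h^L(t)\\\delta_h^R(t)\end{pmatrix}$ with $\delta_h^L(t)\in\mathbb{R}^m$, $\delta_h^R(t)\in\mathbb{R}^2$. For an integer $N\ge1$ let $\Delta t=T/N$, $t_n=n\,\Delta t$, $b_n=b(t_n)$. The $\theta$-method generates, starting from $U_0$, successively for $n=1,\dots,N$ vectors $U_n$ by $$U_n=U_{n-1}+(1-\theta)\,\Delta t\,(MU_{n-1}+b_{n-1})+\theta\,\Delta t\,(MU_n+b_n).$$ The space-time discretization error is $\widehat\varepsilon_n=u_h(t_n)-U_n$ for $0\le n\le N$. For a square matrix $X$ with $I-\theta X$ invertible, $\varphi(X)=(I-\theta X)^{-1}(I+(1-\theta)X)$. The constant $K$ is meant to be independent of $m$ and $n$; the constant $c$ is in particular independent of the spatial grid and of the time step. $|\cdot|_\infty$ is the maximum norm of vectors and $\|\cdot\|_\infty$ the induced matrix norm; $I$ is the identity matrix. The logarithmic maximum norm of a square matrix $X=(\xi_{ij})$ is $\mu_\infty[X]=\lim_{t\downarrow 0}\frac{\|I+tX\|_\infty-1}{t}=\max_i\{\xi_{ii}+\sum_{j\ne i}|\xi_{ij}|\}$. *)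

(* Defs.v *)
(* MathComp / MathComp-Analysis; the reals are an arbitrary R : realType. *)
From HB Require Import structures.
From mathcomp Require Import all_boot all_order all_algebra.
From mathcomp Require Import all_classical all_reals all_analysis.

Set Implicit Arguments.
Unset Strict Implicit.
Unset Printing Implicit Defensive.

Import Order.TTheory GRing.Theory Num.Theory.
Import numFieldNormedType.Exports.

Local Open Scope classical_set_scope.
Local Open Scope ring_scope.

(* Meant for functions that attain their maximum on A. *)
Definition max_over (R : realType) (T : Type) (A : set T) (f : T -> R) : R :=
  sup [set f x | x in A].

(* Derivative at x relative to [a, b]: one-sided at the end points, two-sided
   inside, and independent of the values of f outside [a, b]. *)
Definition diffquot_on (R : realType) (V : normedModType R) (a b : R)
    (f : R -> V) (x : R) : set_system V :=
  (y - x)^-1 *: (f y - f x) @[y --> within `[a, b] x^'].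

Definition derivable_on (R : realType) (V : normedModType R) (a b : R)
    (f : R -> V) (x : R) : Prop :=
  cvg (diffquot_on a b f x).

Definition deriv_on (R : realType) (V : normedModType R) (a b : R)
    (f : R -> V) (x : R) : V :=
  lim (diffquot_on a b f x).

Variant direction := InSpace | InTime.

(* The partial derivative of u on [0, S] x [0, T] along the word w; the head
   of w is the variable differentiated last. *)
Fixpoint partial_on (R : realType) (S T : R) (w : seq direction)
    (u : R -> R -> R) : R -> R -> R :=
  match w with
  | [::] => u
  | InSpace :: w' => fun s t => deriv_on 0 S (fun x => partial_on S T w' u x t) s
  | InTime :: w' => fun s t => deriv_on 0 T (fun x => partial_on S T w' u s x) t
  end.

(* All partial derivatives of orders <= k, mixed ones in every order of
   differentiation, exist and are continuous on [0, S] x [0, T]. *)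
Definition Ck_rectangle (R : realType) (S T : R) (k : nat)
    (u : R -> R -> R) : Prop :=
  (forall w : seq direction, (size w < k)%N ->
     forall s t : R, 0 <= s <= S -> 0 <= t <= T ->
       derivable_on 0 S (fun x => partial_on S T w u x t : R) s /\
       derivable_on 0 T (fun x => partial_on S T w u s x : R) t) /\
  (forall w : seq direction, (size w <= k)%N ->
     {within `[0, S] `*` `[0, T],
       continuous (fun z : R * R => partial_on S T w u z.1 z.2)}).

(* Black-Scholes problem with initial function u0, Dirichlet data g at s = 0
   and the linear boundary condition at s = S. *)
Definition black_scholes (R : realType) (r sigma S T : R) (u0 g : R -> R)
    (u : R -> R -> R) : Prop :=
  [/\ forall s t : R, 0 < s <= S -> 0 < t <= T ->
        partial_on S T [:: InTime] u s t =
          2^-1 * sigma ^+ 2 * s ^+ 2 * partial_on S T [:: InSpace; InSpace] u s t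
          + r * s * partial_on S T [:: InSpace] u s t - r * u s t,
      forall s : R, 0 <= s <= S -> u s 0 = u0 s,
      forall t : R, 0 < t <= T -> u 0 t = g t
    & forall t : R, 0 < t <= T -> partial_on S T [:: InSpace; InSpace] u S t = 0].

Definition is_grid (R : realType) (m : nat) (S : R) (s : nat -> R) : Prop :=
  [/\ s 0%N = 0, s (m + 2)%N = S
    & forall j : nat, (j < m + 2)%N -> s j < s j.+1].

Definition mesh_width (R : realType) (s : nat -> R) (j : nat) : R := s j - s j.-1.

(* The families alpha, beta, gamma are numbered from 1, the matrix indices
   from 0: beta i sits in the 1-based position (i, i-1), gamma i in (i, i+1). *)
Definition mxA (R : realType) (m : nat) (alpha beta gamma : nat -> R) :
    'M[R]_m :=
  \matrix_(i < m, j < m)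
    if i == j :> nat then alpha i.+1
    else if i == j.+1 :> nat then beta i.+1
    else if j == i.+1 :> nat then gamma i.+1
    else 0.

Definition mxB (R : realType) (m : nat) (gamma : nat -> R) : 'M[R]_(m, 2) :=
  \matrix_(i < m, j < 2)
    if (i.+1 == m) && (j == 0 :> nat) then gamma m else 0.

Definition mxC (R : realType) (m : nat) (r S : R) (s : nat -> R) : 'M[R]_2 :=
  (r / mesh_width s (m + 2)) *:
    \matrix_(i < 2, j < 2) if j == 0 :> nat then - S else s m.+1.

Definition mxM (R : realType) (m : nat) (r S : R) (s : nat -> R)
    (alpha beta gamma : nat -> R) : 'M[R]_(m + 2) :=
  block_mx (mxA m alpha beta gamma) (mxB m gamma) 0 (mxC m r S s).

(* On column vectors `|v| is the maximum norm; on square matrices the library's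
   `|X| is the largest entry, so the induced norm has to be defined. *)
Definition opnorm (R : realType) (m : nat) (X : 'M[R]_m) : R :=
  sup [set `|X *m v| | v in [set v : 'cV[R]_m | `|v| <= 1]].

Definition lognorm (R : realType) (m : nat) (X : 'M[R]_m) : R :=
  lim ((opnorm (1%:M + t *: X) - 1) / t @[t --> 0^'+]).

Definition theta_phi (R : realType) (m : nat) (theta : R) (X : 'M[R]_m) : 'M[R]_m :=
  invmx (1%:M - theta *: X) *m (1%:M + (1 - theta) *: X).

Definition grid_values (R : realType) (m : nat) (s : nat -> R)
    (u : R -> R -> R) (t : R) : 'cV[R]_(m + 2) :=
  \col_(i < m + 2) u (s i.+1) t.

Definition truncation_error (R : realType) (m : nat) (T : R) (s : nat -> R)
    (u : R -> R -> R) (M : 'M[R]_(m + 2)) (b : R -> 'cV[R]_(m + 2)) (t : R) :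
    'cV[R]_(m + 2) :=
  deriv_on 0 T (grid_values m s u) t - M *m grid_values m s u t - b t.

Definition theta_method (R : realType) (d : nat) (theta dt : R) (N : nat)
    (M : 'M[R]_d) (b : R -> 'cV[R]_d) (U0 : 'cV[R]_d) (U : nat -> 'cV[R]_d) :
    Prop :=
  U 0%N = U0 /\
  forall n : nat, (1 <= n <= N)%N ->
    U n = U n.-1
      + ((1 - theta) * dt) *: (M *m U n.-1 + b (n.-1%:R * dt))
      + (theta * dt) *: (M *m U n + b (n%:R * dt)).

Definition method_order (R : realType) (theta : R) : nat :=
  if theta == 2^-1 then 2%N else 1%N.

Definition bs_kappa (R : realType) (r sigma S hstar : R) : R :=
  4 * sigma ^+ 2 * S ^+ 3 + 6 * r * S ^+ 2 * hstar.

(* The range S - hstar <= xi <= S is intersected with [0, S], the domain of u;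
   this only matters when hstar > S. *)
Definition bs_eta (R : realType) (S T hstar : R) (u : R -> R -> R) (t : R) : R :=
  max_over `[Num.max 0 (S - hstar), S]
    (fun xi => `|partial_on S T [:: InSpace; InSpace; InSpace] u xi t|).

(* Main.v *)
(* Let e be the error, d the local error (time quadrature plus delta), and
   s = s_{m+1}.  Since C = - r (1, 1)^T w with the row vector
   w = (S, - s) / (S - s) and w (1, 1)^T = 1, the boundary part e^R splits into
   the mean y = w e^R, which obeys the stable scalar recursion of the theta-method
   for y' = - r y, and the remainder z = e^R - y (1, 1)^T, on which C vanishes and
   which just accumulates.  With A p = - r p - gamma_m e_m and
   A q = - gamma_m e_m, the vector f = e^L - y p - z_1 q obeys the theta-method
   for A alone, whose powers are bounded by K; the conditions on r I + A and on
   its last row give |p|, |q| <= 1.  Hence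
     |e_n| <= sum_k (K |d_k^L| + (K + 1) (|w d_k^R| + S |d_{k,2} - d_{k,1}| / (S - s))).
   The division by S - s is harmless: w delta^R and the slope of delta^R are
   O(eta) because u_ss(S) = 0, and those of the quadrature defect are controlled
   by one more space derivative of u. *)
Require Import Defs.
From HB Require Import structures.
From mathcomp Require Import all_boot all_order all_algebra.
From mathcomp Require Import all_classical all_reals all_analysis.
From mathcomp Require Import ring lra zify.

Set Implicit Arguments.
Unset Strict Implicit.
Unset Printing Implicit Defensive.

Import Order.TTheory GRing.Theory Num.Theory.
Import numFieldNormedType.Exports.

Local Open Scope classical_set_scope.
Local Open Scope ring_scope.

(** * One-sided derivatives on an interval, mean value and quadrature estimates *)

(** Every point of the interval is approached from the right or, at [b], from the left. Properness
    makes the limit in [deriv_on] unique. *)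
Lemma within_dnbhs_proper (R : realType) (a b x : R) :
  a < b -> x \in `[a, b] -> ProperFilter (within `[a, b] x^').
Proof.
move=> ab; rewrite in_itv /= => /andP[ax xb].
apply: Build_ProperFilter_ex => P; rewrite /within /= => /nbhs_ballP[e /= e0 eP].
have [xb'|bx] := ltP x b.
  exists (x + Num.min (e / 2) (b - x)).
  have m0 : 0 < Num.min (e / 2) (b - x) by rewrite lt_min divr_gt0//= subr_gt0.
  have m1 : Num.min (e / 2) (b - x) <= e / 2 by rewrite ge_min lexx.
  have m2 : Num.min (e / 2) (b - x) <= b - x by rewrite ge_min lexx orbT.
  move: m0 m1 m2; set d := Num.min _ _ => m0 m1 m2.
  apply: eP => /=.
  - rewrite /ball /= opprD addrA subrr add0r normrN gtr0_norm//; lra.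
  - by apply/eqP => ?; lra.
  - rewrite in_itv /=; apply/andP; split; lra.
exists (x - Num.min (e / 2) (x - a)).
have m0 : 0 < Num.min (e / 2) (x - a) by rewrite lt_min divr_gt0//= subr_gt0; lra.
have m1 : Num.min (e / 2) (x - a) <= e / 2 by rewrite ge_min lexx.
have m2 : Num.min (e / 2) (x - a) <= x - a by rewrite ge_min lexx orbT.
move: m0 m1 m2; set d := Num.min _ _ => m0 m1 m2.
apply: eP => /=.
- rewrite /ball /= opprB addrCA subrr addr0 gtr0_norm//; lra.
- by apply/eqP => ?; lra.
- rewrite in_itv /=; apply/andP; split; lra.
Qed.

Lemma deriv_onP (R : realType) (V : normedModType R) (a b : R) (f : R -> V) (x : R) (l : V) :
  a < b -> x \in `[a, b] -> diffquot_on a b f x --> l ->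
  derivable_on a b f x /\ deriv_on a b f x = l.
Proof.
move=> ab xab fl; have PF := within_dnbhs_proper ab xab.
split; first by apply/cvg_ex; exists l.
exact: cvg_lim fl.
Qed.

Definition has_deriv_on (R : realType) (a b : R) (f f' : R -> R) : Prop :=
  {in `[a, b], forall x, diffquot_on a b f x --> f' x}.

(** [f y] is [y - x] times the quotient plus [f x], and the first term tends to 0. The point [x],
    missing from the punctured filter, is added back at the end. *)
Lemma has_deriv_on_continuous (R : realType) (a b : R) (f f' : R -> R) :
  has_deriv_on a b f f' ->
  {within `[a, b], continuous f}.
Proof.
move=> df; apply/subspace_continuousP => x xab.
have := df x xab; set l := f' x => fl.
have FF : Filter (nbhs (within `[a, b] x^')) by exact: within_filter.
have H : (f y) @[y --> within `[a, b] x^'] --> f x.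
  have : (y - x) * ((y - x)^-1 *: (f y - f x)) + f x @[y --> within `[a, b] x^'] --> 0 * l + f x.
    apply: (@cvgD _ _ _ (within `[a, b] x^') FF); last exact: cvg_cst.
    apply: cvgM => //.
    have : y - x @[y --> within `[a, b] x^'] --> x - x.
      apply: (@cvgB _ _ _ (within `[a, b] x^') FF); last exact: cvg_cst.
      by move=> P nP; apply: filterS (nbhs_dnbhs nP) => y Py _.
    by rewrite subrr.
  rewrite mul0r add0r; apply: cvg_trans.
  apply: near_eq_cvg; apply: (filterS _ (nbhs_dnbhs_neq x)) => y yx _ /=.
  by rewrite /GRing.scale/= mulrA divff ?mul1r ?subrK// subr_eq0.
move=> A /= nA; have {}H : \forall y \near x^', y \in `[a, b] -> A (f y) := H A nA.
apply: (filterS _ (H : \forall y \near nbhs x, y != x -> _)) => y /= Hy yab.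
have [->|yx] := eqVneq y x; first exact: nbhs_singleton.
exact: Hy.
Qed.

(** Near an interior point the restriction to [[a, b]] is void, and [y = h + x] gives the two-sided
    derivative that [MVT] asks for. *)
Lemma diffquot_on_is_derive (R : realType) (a b : R) (f : R -> R) (x l : R) :
  x \in `]a, b[ -> diffquot_on a b f x --> l -> is_derive x 1 f l.
Proof.
rewrite in_itv /= => /andP[ax xb] fl.
have H : h^-1 *: ((f \o shift x) (h *: 1) - f x) @[h --> 0^'] --> l.
  apply/cvgrPdist_le => e e0; move/cvgrPdist_le: fl => /(_ e e0).
  rewrite /within/= => /nbhs_ballP[d /= d0 dP].
  apply/nbhs_ballP; exists (Num.min d (Num.min (x - a) (b - x))) => /=.
    by rewrite !lt_min d0 !subr_gt0 ax.
  move=> h; rewrite /ball /= sub0r normrN !lt_min => /and3P[hd ha hb] h0.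
  have := dP (h + x); rewrite addrK /GRing.scale /= mulr1; apply.
  - by rewrite /ball /= opprD addrCA subrr addr0 normrN.
  - by apply: contra h0 => /eqP h0; apply/eqP; lra.
  - have := ler_norm h; have := ler_norm (- h); rewrite normrN => *.
    by rewrite in_itv /=; apply/andP; split; lra.
apply: DeriveDef; first by apply/cvg_ex; exists l.
exact: cvg_lim H.
Qed.

Lemma has_deriv_onB (R : realType) (a b : R) (f f' g g' : R -> R) :
  has_deriv_on a b f f' -> has_deriv_on a b g g' ->
  has_deriv_on a b (fun x => f x - g x) (fun x => f' x - g' x).
Proof.
move=> df dg x xab.
have FF : Filter (nbhs (within `[a, b] x^')) by exact: within_filter.
rewrite /diffquot_on (_ : (fun y => _) = fun y =>
    (y - x)^-1 *: (f y - f x) - (y - x)^-1 *: (g y - g x)); last first.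
  by apply/funext => y; rewrite -scalerBr !opprD !opprK addrACA.
exact: (@cvgB _ _ _ (within `[a, b] x^') FF _ _ _ _ (df x xab) (dg x xab)).
Qed.

Lemma is_derive_near_itv (R : realType) (a b : R) (f f' : R -> R) (x y z : R) :
  has_deriv_on a b f f' -> a <= x -> y <= b -> z \in `]x, y[ ->
  is_derive z 1 f (f' z).
Proof.
move=> df ax yb; rewrite in_itv /= => /andP[xz zy].
apply: (@diffquot_on_is_derive _ a b); last apply: df;
  rewrite in_itv/=; apply/andP; split; lra.
Qed.

Lemma mean_value_on (R : realType) (a b : R) (f f' : R -> R) (x y : R) :
  has_deriv_on a b f f' -> a <= x -> x < y -> y <= b ->
  exists2 c, c \in `]x, y[ & f y - f x = f' c * (y - x).
Proof.
move=> df ax xy yb; apply: (@MVT R f f') => //.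
  by move=> c; exact: is_derive_near_itv df ax yb.
apply: continuous_subspaceW (has_deriv_on_continuous df).
by apply: subset_itv; rewrite bnd_simp.
Qed.

Lemma mean_value_dist (R : realType) (a b : R) (f f' : R -> R) (x y M : R) :
  has_deriv_on a b f f' -> a <= x -> x <= y -> y <= b ->
  (forall z, x <= z <= y -> `|f' z| <= M) ->
  `|f y - f x| <= M * (y - x).
Proof.
move=> df ax; rewrite le_eqVlt => /predU1P[->|xy] yb fM.
  by rewrite !subrr mulr0 normr0.
have [c] := mean_value_on df ax xy yb.
rewrite in_itv /= => /andP[xc cy] ->.
have yx : 0 < y - x by rewrite subr_gt0.
rewrite normrM (gtr0_norm yx) ler_pM2r//.
by apply: fM; rewrite !ltW.
Qed.

(** The mean value theorem bounds in turn the variation of [f2], the remainder of [f1] and that of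
    [f]. This gives the constant 1 instead of 1/2 and 1/6. *)
Lemma taylor2_on (R : realType) (a b : R) (f f1 f2 f3 : R -> R) (x y M : R) :
  has_deriv_on a b f f1 -> has_deriv_on a b f1 f2 -> has_deriv_on a b f2 f3 ->
  a <= x -> x < y -> y <= b ->
  (forall z, x <= z <= y -> `|f3 z| <= M) ->
  `|f1 y - f1 x - (y - x) * f2 x| <= M * (y - x) ^+ 2 /\
  `|f y - (f x + (y - x) * f1 x + 2^-1 * (y - x) ^+ 2 * f2 x)| <= M * (y - x) ^+ 3.
Proof.
move=> d0 d1 d2 ax xy yb fM.
have H z : x < z -> z <= y -> `|f1 z - f1 x - (z - x) * f2 x| <= M * (z - x) ^+ 2.
  move=> xz zy; have zb := le_trans zy yb.
  have [c] := mean_value_on d1 ax xz zb; rewrite in_itv/= => /andP[xc cz] ->.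
  rewrite mulrC -mulrBr normrM gtr0_norm ?subr_gt0// mulrC expr2 mulrA.
  rewrite ler_pM2r ?subr_gt0//.
  have : `|f2 c - f2 x| <= M * (c - x).
    apply: (mean_value_dist d2) => //; [lra|lra|].
    by move=> w /andP[xw wc]; apply: fM; rewrite xw/=; lra.
  move=> /le_trans; apply; rewrite ler_wpM2l//; last lra.
  by apply: le_trans (normr_ge0 _) (fM x _); rewrite lexx ltW.
split; first exact: H.
(* The derivative of the remainder [g] is the first-order remainder bounded in [H], and
   [g x = 0]. *)
pose g z := f z - (f x + (z - x) * f1 x + 2^-1 * (z - x) ^+ 2 * f2 x).
have [||c] := @MVT R g (fun z => f1 z - f1 x - (z - x) * f2 x) x y xy.
- move=> z zxy; have ? := is_derive_near_itv d0 ax yb zxy.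
  rewrite /g; apply: is_derive_eq.
  rewrite /GRing.scale/=; lra.
- move=> z; apply: cvgB.
    have := continuous_subspaceW _ (has_deriv_on_continuous d0).
    by apply; apply: subset_itv; rewrite bnd_simp.
  apply: (@continuous_subspaceT _ _ _ (fun z => f x + (z - x) * f1 x + 2^-1 * (z - x) ^+ 2 * f2 x)).
  move=> {}z; have cx : w - x @[w --> z] --> z - x.
    by apply: cvgB; [exact: cvg_id|exact: cvg_cst].
  apply: cvgD; first apply: cvgD; first exact: cvg_cst.
    by apply: cvgM => //; exact: cvg_cst.
  apply: cvgM; last exact: cvg_cst.
  by apply: cvgM; [exact: cvg_cst|exact: cvgM].
have gx : g x = 0 by rewrite /g; ring.
rewrite in_itv/= gx subr0 => /andP[xc cy]; rewrite -/(g y) => ->.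
rewrite normrM (@gtr0_norm _ (y - x)) ?subr_gt0// exprSr mulrA ler_pM2r ?subr_gt0//.
apply: le_trans (H c xc (ltW cy)) _.
have M0 : 0 <= M by apply: le_trans (normr_ge0 _) (fM x _); rewrite lexx ltW.
rewrite ler_wpM2l// lerXn2r ?nnegrE; lra.
Qed.

(** [g k] stands for the [k]-th derivative. At [theta = 1/2] the defect combines two Taylor
    remainders, of order 3; otherwise a mean value point [c] reduces it to differences of [g 1], of
    order 2. The factor 2 covers both cases. *)
Lemma theta_quadrature (R : realType) (a b theta : R) (g : nat -> R -> R) (x y M : R) :
  2^-1 <= theta <= 1 ->
  (forall k, (k <= method_order theta)%N -> has_deriv_on a b (g k) (g k.+1)) ->
  a <= x -> x < y -> y <= b ->
  (forall z, x <= z <= y -> `|g (method_order theta).+1 z| <= M) ->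
  `|g 0%N y - g 0%N x - (y - x) * ((1 - theta) * g 1%N x + theta * g 1%N y)|
    <= 2 * M * (y - x) ^+ (method_order theta).+1.
Proof.
move=> /andP[th1 th2] dg ax xy yb gM.
have M0 : 0 <= M by apply: le_trans (normr_ge0 _) (gM x _); rewrite lexx ltW.
move: dg gM; rewrite /method_order; case: eqP => [->|_] dg gM.
  have [] := taylor2_on (dg 0%N isT) (dg 1%N isT) (dg 2%N isT) ax xy yb gM.
  set e1 := _ - _ - _ ; set e0 := g 0%N y - _ => H1 H0.
  have -> : g 0%N y - g 0%N x - (y - x) * ((1 - 2^-1) * g 1%N x + 2^-1 * g 1%N y)
     = e0 - 2^-1 * (y - x) * e1 by rewrite /e0 /e1; field.
  apply: le_trans (ler_normB _ _) _; rewrite !normrM.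
  rewrite (gtr0_norm (_ : 0 < y - x)) ?subr_gt0// [`|2^-1|]gtr0_norm//.
  have : 2^-1 * (y - x) * `|e1| <= 2^-1 * (y - x) * (M * (y - x) ^+ 2).
    by rewrite ler_wpM2l//; lra.
  have : 0 <= M * (y - x) ^+ 3 by rewrite mulr_ge0// exprn_ge0//; lra.
  rewrite !exprS !expr0 in H0 *; nra.
have [c] := mean_value_on (dg 0%N isT) ax xy yb; rewrite in_itv/= => /andP[xc cy] ->.
have -> : g 1%N c * (y - x) - (y - x) * ((1 - theta) * g 1%N x + theta * g 1%N y)
   = (y - x) * ((1 - theta) * (g 1%N c - g 1%N x) - theta * (g 1%N y - g 1%N c)) by ring.
rewrite normrM gtr0_norm ?subr_gt0// expr2 mulrA mulrC ler_pM2r ?subr_gt0//.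
apply: le_trans (ler_normB _ _) _; rewrite !normrM.
rewrite [`|1 - theta|]ger0_norm ?subr_ge0// [`|theta|]ger0_norm; last lra.
have H1 : `|g 1%N c - g 1%N x| <= M * (c - x).
  apply: (mean_value_dist (dg 1%N isT)); try lra.
  by move=> z /andP[z1 z2]; apply: gM; rewrite z1/=; lra.
have H2 : `|g 1%N y - g 1%N c| <= M * (y - c).
  apply: (mean_value_dist (dg 1%N isT)); try lra.
  by move=> z /andP[z1 z2]; apply: gM; rewrite z2 andbT; lra.
have K1 : M * (c - x) <= M * (y - x) by rewrite ler_wpM2l//; lra.
have K2 : M * (y - c) <= M * (y - x) by rewrite ler_wpM2l//; lra.
have J1 : (1 - theta) * `|g 1%N c - g 1%N x| <= (1 - theta) * (M * (y - x)).
  by rewrite ler_wpM2l//; lra.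
have J2 : theta * `|g 1%N y - g 1%N c| <= theta * (M * (y - x)).
  by rewrite ler_wpM2l//; lra.
have : 0 <= M * (y - x) by rewrite mulr_ge0//; lra.
lra.
Qed.

(** * Consequences of smoothness on the closed rectangle *)

(** Derivability is by definition convergence to the very [lim] that [partial_on] takes at
    [InTime :: w]. *)
Lemma Ck_has_deriv_time (R : realType) (S T : R) (k : nat) (u : R -> R -> R)
    (w : seq direction) (s : R) :
  Ck_rectangle S T k u -> (size w < k)%N -> 0 <= s <= S ->
  has_deriv_on 0 T (partial_on S T w u s) (partial_on S T (InTime :: w) u s).
Proof. by move=> [du _] wk sS t; rewrite in_itv/= => tT; exact: (du w wk s t sS tT).2. Qed.

Lemma Ck_has_deriv_space (R : realType) (S T : R) (k : nat) (u : R -> R -> R)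
    (w : seq direction) (t : R) :
  Ck_rectangle S T k u -> (size w < k)%N -> 0 <= t <= T ->
  has_deriv_on 0 S (partial_on S T w u ^~ t) (partial_on S T (InSpace :: w) u ^~ t).
Proof. by move=> [du _] wk tT s; rewrite in_itv/= => sS; exact: (du w wk s t sS tT).1. Qed.

Lemma Ck_rectangle_le (R : realType) (S T : R) (k l : nat) (u : R -> R -> R) :
  (k <= l)%N -> Ck_rectangle S T l u -> Ck_rectangle S T k u.
Proof.
move=> kl [du cu]; split => w wk; first exact/du/(leq_trans wk).
exact/cu/(leq_trans wk).
Qed.

Lemma Ck_bounded (R : realType) (S T : R) (k : nat) (u : R -> R -> R)
    (w : seq direction) :
  Ck_rectangle S T k u -> (size w <= k)%N ->
  exists M, forall s t, 0 <= s <= S -> 0 <= t <= T -> `|partial_on S T w u s t| <= M.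
Proof.
move=> [_ cu] wk; have := cu w wk.
move=> /continuous_compact /(_ (compact_setX (@segment_compact _ _ _) (@segment_compact _ _ _))).
move=> /compact_bounded [M [_ /(_ (M + 1))]]; rewrite ltrDl ltr01 => /(_ isT) H.
exists (M + 1) => s t sS tT; apply: H; exists (s, t) => //.
Qed.

Lemma Ck_continuous_time (R : realType) (S T : R) (k : nat) (u : R -> R -> R)
    (w : seq direction) (s : R) :
  Ck_rectangle S T k u -> (size w <= k)%N -> 0 <= s <= S ->
  {within `[0, T], continuous (partial_on S T w u s)}.
Proof.
move=> [_ cu] wk sS; have /subspace_continuousP cw := cu w wk.
apply/subspace_continuousP => t tT.
have /= := cw (s, t) (conj _ tT); rewrite in_itv /= => /(_ sS) H.
apply: (cvg_comp (G := within (`[0, S] `*` `[0, T]) (nbhs (s, t))) (fun t => (s, t)) _ _ H).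
move=> A /= [[P Q]] /= [nP nQ] PQA; rewrite /nbhs /=.
apply: filterS nQ => x Qx xT; apply: (PQA (s, x)) => /=.
  by split => //=; exact: nbhs_singleton nP.
by split => //=; rewrite in_itv.
Qed.

(* The closure of ]0, T] contains 0. *)
Lemma continuous_eq0_left (R : realType) (T : R) (f : R -> R) :
  0 < T -> {within `[0, T], continuous f} ->
  (forall t, 0 < t <= T -> f t = 0) -> f 0 = 0.
Proof.
move=> T0 /subspace_continuousP /(_ 0) cf f0.
have {cf} /cvgrPdist_lt cf : f t @[t --> within `[0, T] (nbhs 0)] --> f 0.
  by apply: cf; rewrite /= in_itv/= lexx ltW.
apply/eqP; apply: contraT; rewrite -normr_gt0 => /cf.
rewrite /within/= => /nbhs_ballP[e /= e0 eP].
have : ball 0 e (Num.min (e / 2) T).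
  rewrite /ball/= sub0r normrN ger0_norm; first by rewrite gt_min; apply/orP; left; lra.
  by rewrite le_min; apply/andP; split; lra.
move=> /eP; have m0 : 0 < Num.min (e / 2) T by rewrite lt_min T0 divr_gt0.
have mT : Num.min (e / 2) T <= T by rewrite ge_min lexx orbT.
have fm : f (Num.min (e / 2) T) = 0 by apply: f0; rewrite m0.
by rewrite in_itv/= mT (ltW m0) fm subr0 ltxx => /(_ isT).
Qed.

(** * Maximum norm of vectors and maxima over sets *)

Lemma cV_norm_le (R : realType) (m : nat) (v : 'cV[R]_m) (c : R) :
  0 <= c -> (forall i, `|v i 0| <= c) -> `|v| <= c.
Proof.
move=> c0 vc; rewrite /Num.norm/= mx_normrE; apply: bigmax_le => // -[i j] _ /=.
by rewrite ord1.
Qed.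

Lemma cV_norm_ge (R : realType) (m : nat) (v : 'cV[R]_m) (i : 'I_m) : `|v i 0| <= `|v|.
Proof.
rewrite [leRHS]/Num.norm/= mx_normrE.
exact: (le_bigmax _ (fun ij : 'I_m * 'I_1 => `|v ij.1 ij.2|) (i, 0)).
Qed.

Lemma cV_norm_attained (R : realType) (m : nat) (v : 'cV[R]_m) :
  (0 < m)%N -> exists i, `|v i 0| = `|v|.
Proof.
move=> m0; have [v0|v0] := eqVneq `|v| 0.
  exists (Ordinal m0); apply/eqP; rewrite eq_le cV_norm_ge/= v0; exact: normr_ge0.
by have [[i j] /= H] := mx_norm_neq0 v0; exists i; rewrite [RHS]H ord1.
Qed.

Lemma col_diffquot_on (R : realType) (m : nat) (a b x : R) (f : R -> 'cV[R]_m) (l : 'cV[R]_m) :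
  (forall i, diffquot_on a b (fun t => f t i 0) x --> l i 0) ->
  diffquot_on a b f x --> l.
Proof.
move=> fl; have FF : Filter (nbhs (within `[a, b] x^')) by exact: within_filter.
apply/(@cvgrPdist_le _ _ _ (within `[a, b] x^') FF) => e e0.
have H : \forall y \near within `[a, b] x^', forall i, `|l i 0 - (y - x)^-1 * (f y i 0 - f x i 0)| <= e.
  apply: filter_forall => i; have := fl i.
  by move/(@cvgrPdist_le _ _ _ (within `[a, b] x^') FF)=> /(_ e e0).
apply: filterS H => y H; apply: cV_norm_le; first exact: ltW.
by move=> i; rewrite !mxE; exact: H.
Qed.

Lemma continuous_on_bounded (R : realType) (V : normedModType R) (a b : R) (f : R -> V) :
  {within `[a, b], continuous f} ->
  exists M, forall t, a <= t <= b -> `|f t| <= M.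
Proof.
move=> /continuous_compact /(_ (@segment_compact _ _ _)).
move=> /compact_bounded [M [_ /(_ (M + 1))]]; rewrite ltrDl ltr01 => /(_ isT) H.
by exists (M + 1) => t tT; apply: H; exists t => //; rewrite /= in_itv.
Qed.

(** [sup] takes a default value on unbounded sets, so some bound [M] has to be known, whatever its
    size. *)
Lemma max_over_ge (R : realType) (T : Type) (A : set T) (f : T -> R) (M : R) (x : T) :
  (forall y, A y -> f y <= M) -> A x -> f x <= max_over A f.
Proof.
move=> fM Ax; apply: ub_le_sup; last by exists x.
by exists M => _ [y Ay <-]; exact: fM.
Qed.

Lemma max_over_le (R : realType) (T : Type) (A : set T) (f : T -> R) (M : R) (x : T) :
  A x -> (forall y, A y -> f y <= M) -> max_over A f <= M.
Proof.
move=> Ax fM; apply: ge_sup; first by exists (f x), x.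
by move=> _ [y Ay <-]; exact: fM.
Qed.

(** * Consistency at the last two grid points *)

(** Since [f2 S = 0], [f2] is at most [E * (S - s)] on [[s, S]]. The difference quotient is [f1 c]
    for an intermediate [c], so each end slope differs from it by at most that bound times
    [S - s]. *)
Lemma linear_boundary_estimates (R : realType) (S s E : R) (f f1 f2 f3 : R -> R) :
  has_deriv_on 0 S f f1 -> has_deriv_on 0 S f1 f2 -> has_deriv_on 0 S f2 f3 ->
  f2 S = 0 -> 0 < s -> s < S -> (forall z, s <= z <= S -> `|f3 z| <= E) ->
  [/\ `|f2 s| <= E * (S - s),
      `|f1 s - (f S - f s) / (S - s)| <= E * (S - s) ^+ 2
    & `|f1 S - (f S - f s) / (S - s)| <= E * (S - s) ^+ 2].
Proof.
move=> d0 d1 d2 f2S s0 sS fE.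
have E0 : 0 <= E by apply: le_trans (normr_ge0 _) (fE S _); rewrite lexx ltW.
have H2 z : s <= z <= S -> `|f2 z| <= E * (S - s).
  move=> /andP[sz zS]; rewrite -normrN -[- _]add0r -f2S.
  apply: le_trans (_ : E * (S - z) <= _); last by rewrite ler_wpM2l//; lra.
  apply: (mean_value_dist d2); try lra.
  by move=> w /andP[zw wS]; apply: fE; rewrite wS andbT; lra.
have [c] := mean_value_on d0 (ltW s0) sS (lexx S).
rewrite in_itv/= => /andP[sc cS] ->.
have Ss : 0 < S - s by rewrite subr_gt0.
rewrite mulfK ?gt_eqF//.
split; first by apply: H2; rewrite lexx ltW.
- rewrite distrC expr2 mulrA.
  apply: le_trans (_ : E * (S - s) * (c - s) <= _); last first.
    by rewrite ler_wpM2l ?mulr_ge0//; lra.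
  apply: (mean_value_dist d1); try lra.
  by move=> w /andP[zw wS]; apply: H2; rewrite zw/=; lra.
- rewrite expr2 mulrA.
  apply: le_trans (_ : E * (S - s) * (S - c) <= _); last first.
    by rewrite ler_wpM2l ?mulr_ge0//; lra.
  apply: (mean_value_dist d1); try lra.
  by move=> w /andP[zw wS]; apply: H2; rewrite wS andbT; lra.
Qed.

(** [Cu] equals both [r * (s * D - us)] and [r * (S * D - uS)]. Hence the values of [u] cancel in
    [d1] and [d2], and only [us2] and the slope errors remain, each with a factor [h] that pays for
    the division by [h]. *)
Lemma boundary_truncation (R : realType) (S s r sigma E us uS us1 uS1 us2 : R)
    (h := S - s) (D := (uS - us) / h)
    (Cu := r / h * (- S * us + s * uS))
    (d1 := 2^-1 * sigma ^+ 2 * s ^+ 2 * us2 + r * s * us1 - r * us - Cu)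
    (d2 := r * S * uS1 - r * uS - Cu) :
  0 < s -> s < S -> 0 <= r ->
  `|us2| <= E * h -> `|us1 - D| <= E * h ^+ 2 -> `|uS1 - D| <= E * h ^+ 2 ->
  `|(S * d1 - s * d2) / h| <= (2^-1 * sigma ^+ 2 * S ^+ 3 + 2 * r * S ^+ 2 * h) * E /\
  `|S * (d2 - d1) / h| <= (2^-1 * sigma ^+ 2 * S ^+ 3 + 2 * r * S ^+ 2 * h) * E.
Proof.
move=> s0 sS r0 e2 e1s e1S.
have h0 : 0 < h by rewrite subr_gt0.
have S0 : 0 < S by lra.
have hn : S - s != 0 by rewrite gt_eqF.
have E0 : 0 <= E by rewrite -(pmulr_lge0 _ h0) (le_trans _ e2).
have -> : d1 = 2^-1 * sigma ^+ 2 * s ^+ 2 * us2 + r * s * (us1 - D).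
  by rewrite /d1 /Cu /D /h; field.
have -> : d2 = r * S * (uS1 - D).
  by rewrite /d2 /Cu /D /h; field.
set x2 := us2 in e2 *; set x1 := us1 - D in e1s *; set xS := uS1 - D in e1S *.
have sg : 0 <= sigma ^+ 2 by exact: sqr_ge0.
have A2 : `|sigma ^+ 2 * s ^+ 2 * x2| <= sigma ^+ 2 * S ^+ 2 * (E * h).
  rewrite normrM (ger0_norm (mulr_ge0 sg (sqr_ge0 s))).
  apply: ler_pM => //; first exact: mulr_ge0 sg (sqr_ge0 s).
  by rewrite ler_wpM2l// lerXn2r// ?nnegrE; lra.
have A1 : `|r * s * x1| <= r * S * (E * h ^+ 2).
  rewrite normrM (ger0_norm (_ : 0 <= r * s)) ?mulr_ge0//; last exact: ltW.
  apply: ler_pM => //; first by rewrite mulr_ge0//; exact: ltW.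
  by rewrite ler_wpM2l//; exact: ltW.
have AS : `|r * S * xS| <= r * S * (E * h ^+ 2).
  rewrite normrM (ger0_norm (_ : 0 <= r * S)) ?mulr_ge0//; last exact: ltW.
  by rewrite ler_wpM2l// mulr_ge0//; lra.
have -> : 2^-1 * sigma ^+ 2 * s ^+ 2 * x2 = 2^-1 * (sigma ^+ 2 * s ^+ 2 * x2) by ring.
move: A2 A1 AS; set a2 := _ * x2; set a1 := _ * x1; set aS := _ * xS => A2 A1 AS.
have bnd : (2^-1 * sigma ^+ 2 * S ^+ 3 + 2 * r * S ^+ 2 * h) * E
  = S * (2^-1 * (sigma ^+ 2 * S ^+ 2 * (E * h)) + r * S * (E * h ^+ 2) + r * S * (E * h ^+ 2)) / h.
  by field; rewrite gt_eqF.
rewrite bnd !normrM !(gtr0_norm (_ : 0 < h^-1)) ?invr_gt0// !ler_pM2r ?invr_gt0//.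
split; last first.
  rewrite (gtr0_norm S0) ler_pM2l//.
  move: A2 A1 AS; rewrite !ler_norml => /andP[? ?] /andP[? ?] /andP[? ?].
  by apply/andP; split; lra.
apply: le_trans (_ : S * (`|2^-1 * a2 + a1| + `|aS|) <= _).
  rewrite [leRHS]mulrDr; apply: le_trans (ler_normB _ _) _.
  rewrite (normrM S) (normrM s) (gtr0_norm S0) (gtr0_norm s0).
  by rewrite lerD2l ler_wpM2r// ltW.
rewrite ler_pM2l//; apply: lerD => //; apply: le_trans (ler_normD _ _) _.
by rewrite normrM (@gtr0_norm _ 2^-1)//; apply: lerD => //; rewrite ler_pM2l.
Qed.

(** * Induced norm, logarithmic norm and diagonal dominance *)

(** The sign vector of row [i] attains the [i]-th absolute row sum. *)
Lemma opnormE (R : realType) (m : nat) (X : 'M[R]_m) :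
  opnorm X = \big[Num.max/0]_i \sum_j `|X i j|.
Proof.
set b := \big[_/_]_i _.
have bP (v : 'cV[R]_m) : `|v| <= 1 -> `|X *m v| <= b.
  move=> v1; have b0 : 0 <= b by exact: bigmax_ge_id.
  apply: cV_norm_le => // i; apply: le_trans (le_bigmax _ _ i).
  rewrite mxE; apply: le_trans (ler_norm_sum _ _ _) _; apply: ler_sum => j _.
  by rewrite normrM ler_piMr// (le_trans (cV_norm_ge _ _)).
have ubS : has_ubound [set `|X *m v| | v in [set v : 'cV[R]_m | `|v| <= 1]].
  by exists b => _ [v v1 <-]; exact: bP.
apply/eqP; rewrite eq_le; apply/andP; split.
  apply: ge_sup; last by move=> _ [v v1 <-]; exact: bP.
  by exists `|X *m (0 : 'cV[R]_m)|, 0 => //=; rewrite normr0.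
apply: bigmax_le => [|i _].
  by apply: ub_le_sup => //; exists 0; rewrite /= ?mulmx0 normr0.
pose v : 'cV[R]_m := \col_j Num.sg (X i j).
apply: le_trans (_ : `|X *m v| <= _); last first.
  apply: ub_le_sup => //; exists v => //.
    apply: (cV_norm_le ler01) => // j; rewrite mxE normr_sg.
  by case: (_ != _).
apply: le_trans (cV_norm_ge _ i); rewrite mxE; apply: le_trans (ler_norm _).
by apply: ler_sum => j _; rewrite mxE mulrC normrEsg.
Qed.

Lemma opnorm_ge0 (R : realType) (m : nat) (X : 'M[R]_m) : 0 <= opnorm X.
Proof. by rewrite opnormE bigmax_ge_id. Qed.

Lemma norm_mulmx_le_opnorm (R : realType) (m : nat) (X : 'M[R]_m) (v : 'cV[R]_m) :
  `|X *m v| <= opnorm X * `|v|.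
Proof.
apply: cV_norm_le => [|i]; first by rewrite mulr_ge0// opnorm_ge0.
rewrite mxE; apply: le_trans (ler_norm_sum _ _ _) _.
apply: le_trans (_ : (\sum_j `|X i j|) * `|v| <= _).
  by rewrite mulr_suml; apply: ler_sum => j _; rewrite normrM ler_wpM2l// cV_norm_ge.
by rewrite ler_wpM2r// opnormE; exact: (le_bigmax _ (fun i => \sum_j `|X i j|)).
Qed.

Lemma opnorm1 (R : realType) (m : nat) : (0 < m)%N -> opnorm (1%:M : 'M[R]_m) = 1.
Proof.
move=> m0; have rowE i : \sum_j `|(1%:M : 'M[R]_m) i j| = 1.
  rewrite (bigD1 i)//= mxE eqxx normr1 big1 ?addr0// => j ji.
  by rewrite mxE eq_sym (negbTE ji) normr0.
rewrite opnormE (eq_bigr _ (fun i _ => rowE i)).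
apply/eqP; rewrite eq_le; apply/andP; split; first by apply: bigmax_le.
exact: (le_bigmax _ (fun=> 1) (Ordinal m0)).
Qed.

(** The quantity whose maximum over the rows is the logarithmic maximum norm. *)
Definition log_row (R : realType) (m : nat) (X : 'M[R]_m) (i : 'I_m) : R :=
  X i i + \sum_(j | j != i) `|X i j|.

(** For small [t > 0] the diagonal of [1%:M + t *: X] is nonnegative, so the quotient in [lognorm]
    is constant, equal to the largest [log_row]. *)
Lemma log_row_le_lognorm (R : realType) (m : nat) (X : 'M[R]_m) (i : 'I_m) :
  log_row X i <= lognorm X.
Proof.
have [k _ kP] := @arg_maxP _ _ _ i predT (log_row X) isT.
apply: le_trans (kP i isT) _; rewrite le_eqVlt; apply/orP; left; apply/eqP.
apply/esym; apply: cvg_lim => //; apply: cvg_near_cst.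
(* [b] dominates every [|X j j|], so [t * b <= 1] keeps all [1 + t * X j j] nonnegative. *)
pose b := 1 + \sum_i `|X i i|.
have b0 : 0 < b by rewrite ltr_pwDl// sumr_ge0.
near=> t; have t0 : 0 < t by near: t; exact: nbhs_right_gt.
have tb : t * b <= 1.
  rewrite -ler_pdivlMr// mul1r; near: t; apply: nbhs_right_le.
  by rewrite invr_gt0.
have rowE j : \sum_l `|(1%:M + t *: X) j l| = 1 + t * log_row X j.
  rewrite (bigD1 j)//= /log_row mulrDr mulr_sumr addrA; congr (_ + _).
    rewrite !mxE eqxx ger0_norm// -lerBlDl sub0r -[leLHS]opprK lerNl opprK.
    apply: le_trans tb; rewrite -mulrN ler_wpM2l ?(ltW t0)//.
    apply: le_trans (_ : `|X j j| <= _); first by rewrite -normrN ler_norm.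
    rewrite /b (bigD1 j)//= addrCA lerDl addr_ge0// sumr_ge0//.
  apply: eq_bigr => l lj; rewrite !mxE eq_sym (negbTE lj) add0r normrM.
  by rewrite gtr0_norm.
rewrite opnormE (eq_bigr _ (fun j _ => rowE j)).
have -> : \big[Num.max/0]_j (1 + t * log_row X j) = 1 + t * log_row X k.
  apply/eqP; rewrite eq_le; apply/andP; split; last first.
    exact: (le_bigmax _ (fun j => 1 + t * log_row X j)).
  apply: bigmax_le => [|j _]; first by rewrite -rowE sumr_ge0.
  by rewrite lerD2l ler_pM2l//; exact: kP.
by rewrite addrAC subrr add0r mulrAC divff ?mul1r ?gt_eqF.
Unshelve. all: by end_near. Qed.

(** In a row where [v] has its largest entry, the off-diagonal terms take away at most their
    absolute row sum times [|v|] from the diagonal term. *)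
Lemma log_row_norm_mulmx (R : realType) (m : nat) (X : 'M[R]_m) (v : 'cV[R]_m) (i : 'I_m) :
  `|v i 0| = `|v| -> - log_row X i * `|v| <= `|(X *m v) i 0|.
Proof.
move=> vi; rewrite mxE (bigD1 i)//=; apply: le_trans (lerB_normD _ _).
rewrite normrM vi /log_row opprD mulrDl.
apply: lerD; first by rewrite ler_wpM2r// -normrN ler_norm.
rewrite mulNr lerN2 mulr_suml; apply: le_trans (ler_norm_sum _ _ _) _.
by apply: ler_sum => j _; rewrite normrM ler_wpM2l// cV_norm_ge.
Qed.

Lemma norm_mulmx_ge (R : realType) (m : nat) (X : 'M[R]_m) (w : R) (v : 'cV[R]_m) :
  (0 < m)%N -> (forall i, log_row X i <= - w) -> w * `|v| <= `|X *m v|.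
Proof.
move=> m0 Xw; have [i vi] := cV_norm_attained v m0.
apply: le_trans (cV_norm_ge _ i); apply: le_trans (log_row_norm_mulmx _ vi).
by rewrite ler_wpM2r// lerNr Xw.
Qed.

(** Strict diagonal dominance: the lower bound on [|X *m v|] makes the kernel trivial. The transpose
    appears because row-freeness concerns row vectors. *)
Lemma log_row_unitmx (R : realType) (m : nat) (X : 'M[R]_m) (w : R) :
  (0 < m)%N -> 0 < w -> (forall i, log_row X i <= - w) -> X \in unitmx.
Proof.
move=> m0 w0 Xw; rewrite -unitmx_tr -row_free_unit; apply: inj_row_free => v vX.
apply/trmx_inj/eqP; rewrite trmx0 -normr_le0 -(pmulr_rle0 _ w0).
by rewrite (le_trans (norm_mulmx_ge _ m0 Xw))// -[X]trmxK -trmx_mul vX trmx0 normr0.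
Qed.

Lemma log_row_addmx_scalar (R : realType) (m : nat) (X : 'M[R]_m) (w : R) (i : 'I_m) :
  log_row (w%:M + X) i = w + log_row X i.
Proof.
rewrite /log_row !mxE eqxx mulr1n addrA; congr (_ + _); apply: eq_bigr => j ji.
by rewrite !mxE eq_sym (negbTE ji) mulr0n add0r.
Qed.

Lemma log_row_scale (R : realType) (m : nat) (X : 'M[R]_m) (w : R) (i : 'I_m) :
  0 <= w -> log_row (w *: X) i = w * log_row X i.
Proof.
move=> w0; rewrite /log_row !mxE mulrDr mulr_sumr; congr (_ + _).
by apply: eq_bigr => j _; rewrite !mxE normrM ger0_norm.
Qed.

(** Take a row [i] where [|x|] is attained. If [i = l], the hypothesis on row [l] gives the bound 1;
    otherwise the right-hand side vanishes there, which forces [|x| <= 0]. *)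
Lemma solve_delta_strict (R : realType) (m : nat) (X : 'M[R]_m) (w g : R) (l : 'I_m)
    (x : 'cV[R]_m) :
  0 < w -> (forall i, log_row X i <= - w) -> log_row X l + `|g| <= 0 ->
  X *m x = g *: delta_mx l 0 -> `|x| <= 1.
Proof.
move=> w0 Xw Xl Xx; have m0 : (0 < m)%N by apply: leq_ltn_trans (ltn_ord l).
have [i xi] := cV_norm_attained x m0.
have := log_row_norm_mulmx X xi; rewrite Xx !mxE eqxx andbT.
have [->|il] := eqVneq i l.
  rewrite mulr1 => H; have D0 : 0 < - log_row X l by rewrite (lt_le_trans w0)// lerNr.
  by rewrite -(ler_pM2l D0) mulr1 (le_trans H)//; lra.
rewrite mulr0 normr0 pmulr_rle0; first by move/le_trans; apply.
by rewrite (lt_le_trans w0)// lerNr.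
Qed.

(** Weak dominance is a limit of strict dominance: invertibility of [X] controls the change of the
    solution under a small shift, and [w] is chosen to make this change at most [e]. *)
Lemma solve_delta (R : realType) (m : nat) (X : 'M[R]_m) (g : R) (l : 'I_m)
    (x : 'cV[R]_m) :
  X \in unitmx -> (forall i, log_row X i <= 0) -> log_row X l + `|g| <= 0 ->
  X *m x = g *: delta_mx l 0 -> `|x| <= 1.
Proof.
move=> Xu X0 Xl Xx; have m0 : (0 < m)%N by apply: leq_ltn_trans (ltn_ord l).
apply/ler_addgt0Pr => e e0; pose L := opnorm (invmx X).
have L0 : 0 <= L by exact: opnorm_ge0.
pose w := e / (L + 1); have w0 : 0 < w by rewrite divr_gt0// ltr_wpDl.
(* Shifting X by -w makes it strictly diagonally dominant. *)
pose Y := (- w)%:M + X.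
have Yrow i : log_row Y i <= - w by rewrite log_row_addmx_scalar gerDl.
have Yu := log_row_unitmx m0 w0 Yrow.
pose z : 'cV[R]_m := invmx Y *m (g *: delta_mx l 0).
have Yz : Y *m z = g *: delta_mx l 0 by rewrite /z mulKVmx.
have z1 : `|z| <= 1.
  apply: (solve_delta_strict w0 Yrow) Yz.
  by rewrite log_row_addmx_scalar -addrA addrC (le_trans _ Xl)// gerDl oppr_le0 ltW.
have xz : x - z = invmx X *m (- (w *: z)).
  rewrite -[LHS](mulKmx Xu); congr (_ *m _).
  by rewrite mulmxBr Xx -Yz /Y mulmxDl mul_scalar_mx scaleNr addrK.
rewrite -[x](subrK z) addrC; apply: le_trans (ler_normD _ _) _; apply: lerD => //.
rewrite xz; apply: le_trans (norm_mulmx_le_opnorm _ _) _.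
rewrite normrN normrZ (gtr0_norm w0) -/L.
apply: le_trans (_ : L * w <= _); first by rewrite ler_wpM2l// ler_piMr// ltW.
rewrite /w mulrA ler_pdivrMr ?ltr_wpDl// mulrC ler_wpM2l//; first exact: ltW.
by rewrite lerDl.
Qed.

(** * Rows and blocks of the semidiscrete matrix *)

Lemma log_row_mxA_last (R : realType) (m : nat) (alpha beta gamma : nat -> R) (l : 'I_m) :
  (2 <= m)%N -> l.+1 = m -> log_row (mxA m alpha beta gamma) l <= alpha m + `|beta m|.
Proof.
move=> m2 lm; rewrite /log_row mxE eqxx lm; apply: lerD => //.
(* The last row has a single off-diagonal entry, [beta m] in the 0-based column [m.-2]; [2 <= m]
   separates this column from the diagonal. *)
have jm : (m.-2 < m)%N by lia.
rewrite (bigD1 (Ordinal jm)) /=; last first.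
  by apply/eqP => /(congr1 val) /=; lia.
rewrite big1 ?addr0.
  rewrite mxE /= (_ : (l == m.-2 :> nat) = false); last by apply/eqP; lia.
  by rewrite (_ : (l == m.-2.+1 :> nat)) ?lm//; apply/eqP; lia.
move=> j /andP[jl jj]; rewrite mxE.
have -> : (l == j :> nat) = false by apply: contraNF jl => /eqP /val_inj ->.
have -> : (l == j.+1 :> nat) = false.
  by apply: contraNF jj => /eqP H; apply/eqP/val_inj => /=; lia.
have -> : (j == l.+1 :> nat) = false by apply/eqP; have := ltn_ord j; lia.
by rewrite normr0.
Qed.

Lemma usubmx_mxM (R : realType) (m : nat) (r S : R) (s alpha beta gamma : nat -> R)
    (v : 'cV[R]_(m + 2)) (l : 'I_m) :
  l.+1 = m ->
  usubmx (mxM m r S s alpha beta gamma *m v) =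
  mxA m alpha beta gamma *m usubmx v + (gamma m * dsubmx v 0 0) *: delta_mx l 0.
Proof.
move=> lm; rewrite -{1}(vsubmxK v) /mxM mul_block_col col_mxKu; congr (_ + _).
apply/matrixP => i j; rewrite ord1 !mxE big_ord_recl big_ord_recl big_ord0 !mxE /=.
rewrite andbF mul0r !addr0 andbT.
have -> : (i.+1 == m) = (i == l) by rewrite -[in X in _ == X]lm eqSS.
by case: eqP; rewrite ?mulr1 ?mul0r ?mulr0//= ?andbT.
Qed.

Lemma dsubmx_mxM (R : realType) (m : nat) (r S : R) (s alpha beta gamma : nat -> R)
    (v : 'cV[R]_(m + 2)) (i : 'I_2) :
  dsubmx (mxM m r S s alpha beta gamma *m v) i 0 =
  r / mesh_width s (m + 2) * (- S * dsubmx v 0 0 + s m.+1 * dsubmx v 1 0).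
Proof.
rewrite -{1}(vsubmxK v) /mxM mul_block_col col_mxKd mul0mx add0r.
rewrite mxE big_ord_recl big_ord_recl big_ord0 !mxE /= addr0 mulrDr !mulrA.
by congr (_ * _ + _ * _); congr (v _ _); apply: val_inj.
Qed.

(** * Stability of the theta-method *)

(** For [theta >= 1/2] the amplification factor [(1 - (1 - theta) * x) / (1 + theta * x)] lies in
    [[-1, 1]], and the perturbation is divided by a number at least 1. *)
Lemma theta_scalar_step (R : realType) (theta x y0 y d : R) :
  2^-1 <= theta -> 0 <= x ->
  y = y0 - x * ((1 - theta) * y0 + theta * y) + d -> `|y| <= `|y0| + `|d|.
Proof.
move=> th x0 H; pose D := 1 + theta * x.
have thx : 0 <= theta * x by rewrite mulr_ge0//; lra.
have D1 : 1 <= D by rewrite lerDl.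
have D0 : 0 < D by lra.
have Hy : D * y = (1 - (1 - theta) * x) * y0 + d by rewrite /D; lra.
rewrite -(ler_pM2l D0) -{1}(gtr0_norm D0) -normrM Hy.
apply: le_trans (ler_normD _ _) _; rewrite normrM mulrDr; apply: lerD.
  rewrite ler_wpM2r// ler_norml /D; apply/andP; split; nra.
by rewrite ler_peMl.
Qed.

(** Solved for the new value, the recursion applies [phi] to the old one and adds [invmx Z *m g].
    Nonpositive [log_row A] makes [invmx Z] a contraction, so each perturbation contributes at most
    [K * c]. *)
Lemma theta_recursion_norm (R : realType) (m N : nat) (theta dt K c : R) (A : 'M[R]_m)
    (f g : nat -> 'cV[R]_m) :
  (0 < m)%N -> 0 <= theta -> 0 <= dt -> (forall i, log_row A i <= 0) ->
  (forall n, (n <= N)%N -> opnorm (theta_phi theta (dt *: A) ^+ n) <= K) ->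
  f 0%N = 0 ->
  (forall n, (n < N)%N ->
     f n.+1 = f n + ((1 - theta) * dt) *: (A *m f n) + (theta * dt) *: (A *m f n.+1) + g n.+1) ->
  (forall n, (n < N)%N -> `|g n.+1| <= c) ->
  forall n, (n <= N)%N -> `|f n| <= n%:R * (K * c).
Proof.
move=> m0 th dt0 A0 phiK f0 fS gc.
pose X := dt *: A; pose Z := 1%:M - theta *: X; pose phi := theta_phi theta X.
have K0 : 0 <= K by apply: le_trans (phiK 0%N (leq0n _)); exact: opnorm_ge0.
have Zrow i : log_row (- Z) i <= - 1.
  have -> : - Z = (- 1)%:M + theta *: X by rewrite /Z opprB addrC raddfN.
  rewrite log_row_addmx_scalar gerDl /X scalerA log_row_scale ?mulr_ge0//.
  by rewrite mulr_ge0_le0// mulr_ge0.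
have Zn (v : 'cV[R]_m) : `|v| <= `|Z *m v|.
  by rewrite -[leRHS]normrN -mulNmx -[leLHS]mul1r norm_mulmx_ge.
have Zu : Z \in unitmx.
  by have := log_row_unitmx m0 ltr01 Zrow; rewrite -scaleN1r unitmxZ// unitrN1.
have fphi n : (n < N)%N -> f n.+1 = phi *m f n + invmx Z *m g n.+1.
  move=> nN; rewrite /phi /theta_phi -/Z -mulmxA -mulmxDr.
  rewrite -[LHS](mulKmx Zu); congr (_ *m _).
  rewrite /Z /X !scalerA mulmxBl mulmxDl !mul1mx -!scalemxAl.
  by rewrite {1}(fS n nN) addrAC addrK.
(* Carrying every power of [phi] through the induction charges [K] once per perturbation; bounding
   [phi] step by step would compound it. *)
suff H n j : (n + j <= N)%N -> `|(phi ^+ j) *m f n| <= n%:R * (K * c).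
  by move=> n nN; have := H n 0%N; rewrite addn0 expr0 mul1mx; exact.
elim: n j => [|n IH] j nN; first by rewrite f0 mulmx0 normr0 mul0r.
have nN' : (n < N)%N by lia.
rewrite fphi// mulmxDr mulmxA -[phi ^+ j *m phi]/(phi ^+ j * phi) -exprSr.
apply: le_trans (ler_normD _ _) _; rewrite -natr1 mulrDl mul1r; apply: lerD.
  by apply: IH; lia.
apply: le_trans (norm_mulmx_le_opnorm _ _) _; apply: ler_pM => //.
- exact: opnorm_ge0.
- by apply: phiK; lia.
- by apply: le_trans (Zn _) _; rewrite mulKVmx// gc.
Qed.

(* The row vector w of the header, applied to v. *)
Definition boundary_mean (R : realType) (S s : R) (v : 'cV[R]_2) : R :=
  (S * v 0 0 - s * v 1 0) / (S - s).

(** This is the second entry of [v] minus its boundary mean; the first entry has [s] in place of the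
    factor [S], so for [0 < s < S] this quantity dominates both. *)
Definition boundary_slope (R : realType) (S s : R) (v : 'cV[R]_2) : R :=
  S * (v 1 0 - v 0 0) / (S - s).

(** Purely algebraic form of the splitting: [e] is any solution of the recursion, and [a], [b1],
    [b2] bound the interior part, the mean and the slope of its perturbation. *)
Lemma error_stability (R : realType) (m N : nat) (theta dt r S K a b1 b2 : R)
    (s alpha beta gamma : nat -> R) (e d : nat -> 'cV[R]_(m + 2)) :
  let A := mxA m alpha beta gamma in
  let M := mxM m r S s alpha beta gamma in
  (2 <= m)%N -> 2^-1 <= theta -> 0 <= dt -> 0 < r ->
  s (m + 2)%N = S -> 0 < s m.+1 -> s m.+1 < S ->
  r%:M + A \in unitmx -> (forall i, log_row (r%:M + A) i <= 0) ->
  r + alpha m + `|beta m| + `|gamma m| <= 0 ->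
  (forall n, (n <= N)%N -> opnorm (theta_phi theta (dt *: A) ^+ n) <= K) ->
  e 0%N = 0 ->
  (forall n, (n < N)%N ->
     e n.+1 = e n + ((1 - theta) * dt) *: (M *m e n) + (theta * dt) *: (M *m e n.+1) + d n.+1) ->
  (forall n, (n < N)%N ->
     [/\ `|usubmx (d n.+1)| <= a,
         `|boundary_mean S (s m.+1) (dsubmx (d n.+1))| <= b1
       & `|boundary_slope S (s m.+1) (dsubmx (d n.+1))| <= b2]) ->
  forall n, (n <= N)%N -> `|e n| <= n%:R * (K * a + (K + 1) * (b1 + b2)).
Proof.
move=> A M m2 th dt0 r0 sS s0 ltS rAu rA0 last0 phiK e0 eS db n nN.
have m0 : (0 < m)%N by lia.
have m1 : (m.-1 < m)%N by lia.
pose l := Ordinal m1; have lm : l.+1 = m by rewrite /=; lia.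
have hE : mesh_width s (m + 2) = S - s m.+1 by rewrite /mesh_width sS addn2.
have h0 : 0 < S - s m.+1 by rewrite subr_gt0.
have hN0 : S - s m.+1 != 0 by rewrite gt_eqF.
have K1 : 1 <= K by have := phiK 0%N (leq0n _); rewrite expr0 opnorm1.
pose E i n := dsubmx (e n) i 0; pose D i n := dsubmx (d n) i 0.
pose y n := boundary_mean S (s m.+1) (dsubmx (e n)).
pose yd n := boundary_mean S (s m.+1) (dsubmx (d n)).
have CE i k : dsubmx (M *m e k) i 0 = - r * y k.
  by rewrite dsubmx_mxM hE /y /boundary_mean; field.
have ES i k : (k < N)%N ->
    E i k.+1 = E i k - r * dt * ((1 - theta) * y k + theta * y k.+1) + D i k.+1.
  move=> kN; have -> : E i k.+1 = E i k + (1 - theta) * dt * dsubmx (M *m e k) i 0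
      + theta * dt * dsubmx (M *m e k.+1) i 0 + D i k.+1.
    by rewrite /E /D {1}(eS k kN) !mxE.
  by rewrite !CE; ring.
have yE k : y k = (S * E 0 k - s m.+1 * E 1 k) / (S - s m.+1) by [].
have ydE k : yd k = (S * D 0 k - s m.+1 * D 1 k) / (S - s m.+1) by [].
have yS k : (k < N)%N ->
    y k.+1 = y k - r * dt * ((1 - theta) * y k + theta * y k.+1) + yd k.+1.
  move=> kN; rewrite {1}(yE k.+1) !ES// ydE.
  (* The relation is implicit: only the left-hand [y k.+1] has been expanded, those on the right are
     kept as an atom. *)
  by move: (y k.+1) => y'; rewrite yE; field.
pose z i n := E i n - y n.
pose c (i : 'I_2) := (if i == 0 then s m.+1 else S) / (S - s m.+1).
have c_bnd i (v : 'cV[R]_2) : `|c i * (v 1 0 - v 0 0)| <= `|boundary_slope S (s m.+1) v|.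
  rewrite /boundary_slope mulrAC normrM [leRHS]normrM ler_wpM2r// /c.
  rewrite !normrM ler_wpM2r// !gtr0_norm//; last by case: ifP => _; lra.
    by case: ifP => _; lra.
  lra.
have zS i k : (k < N)%N -> z i k.+1 = z i k + c i * (D 1 k.+1 - D 0 k.+1).
  move=> kN; rewrite /z ES//; set x := r * dt * _.
  have -> : y k.+1 = y k - x + yd k.+1 := yS k kN.
  rewrite ydE /c.
  have [->|->] : i = 0 \/ i = 1 by case: i => [[|[]]]//= ?; [left|right]; apply: val_inj.
    by rewrite eqxx; field.
  by rewrite (_ : (1 == 0 :> 'I_2) = false)//; field.
have E0 i : E i 0%N = 0 by rewrite /E e0 !mxE.
have y0 : y 0%N = 0 by rewrite yE !E0; field.
have ybnd k : (k <= N)%N -> `|y k| <= k%:R * b1.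
  elim: k => [|k IH] kN; first by rewrite y0 normr0 mul0r.
  have rdt : 0 <= r * dt by rewrite mulr_ge0// ltW.
  apply: le_trans (theta_scalar_step th rdt (yS k kN)) _.
  rewrite -natr1 mulrDl mul1r; apply: lerD; first exact/IH/ltnW.
  by have [] := db k kN.
have zbnd i k : (k <= N)%N -> `|z i k| <= k%:R * b2.
  elim: k => [|k IH] kN; first by rewrite /z E0 y0 subrr normr0 mul0r.
  rewrite zS//; apply: le_trans (ler_normD _ _) _.
  rewrite -natr1 mulrDl mul1r; apply: lerD; first exact/IH/ltnW.
  by have [_ _] := db k kN; apply: le_trans; exact: c_bnd.
have A0 i : log_row A i <= - r by have := rA0 i; rewrite log_row_addmx_scalar; lra.
have Au := log_row_unitmx m0 r0 A0.
have Al : r + log_row A l + `|gamma m| <= 0.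
  by have := log_row_mxA_last alpha beta gamma m2 lm; rewrite -/A; lra.
pose p : 'cV[R]_m := invmx (r%:M + A) *m (- gamma m *: delta_mx l 0).
pose q : 'cV[R]_m := invmx A *m (- gamma m *: delta_mx l 0).
have rAp : (r%:M + A) *m p = - gamma m *: delta_mx l 0 by rewrite mulKVmx.
have Aq : A *m q = - gamma m *: delta_mx l 0 by rewrite mulKVmx.
(* The rows of [r%:M + A] are only weakly dominant, whereas those of [A] have the margin [r]; hence
   the two different lemmas for [p] and [q]. *)
have p1 : `|p| <= 1.
  apply: solve_delta rAu rA0 _ rAp.
  by rewrite log_row_addmx_scalar normrN.
have q1 : `|q| <= 1.
  by apply: (solve_delta_strict r0 A0) Aq; rewrite normrN; lra.
have Ap : A *m p = - gamma m *: delta_mx l 0 - r *: p.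
  by rewrite -rAp mulmxDl mul_scalar_mx addrC addKr.
pose f n : 'cV[R]_m := usubmx (e n) - y n *: p - z 0 n *: q.
pose g n : 'cV[R]_m := usubmx (d n) - yd n *: p - (c 0 * (D 1 n - D 0 n)) *: q.
(* [B] feeds [gamma m] times the first boundary entry [y + z 0] into the last row; [p] and [q]
   absorb it. The leftover [r * y] multiple of [p] is cancelled by the recursion for [y]. *)
have Af k : A *m f k = usubmx (M *m e k) + (r * y k) *: p.
  rewrite (usubmx_mxM _ _ _ _ _ _ _ lm) -/A !mulmxBr -!scalemxAr Ap Aq.
  have e0E : e k (rshift m 0) 0 = E 0 k by rewrite /E mxE.
  apply/matrixP => i j; rewrite !mxE e0E /z; move: (\sum_(_ < _) _) => x.
  by ring.
have fS k : (k < N)%N ->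
    f k.+1 = f k + ((1 - theta) * dt) *: (A *m f k) + (theta * dt) *: (A *m f k.+1) + g k.+1.
  move=> kN; have eL : usubmx (e k.+1) = usubmx (e k) + ((1 - theta) * dt) *: usubmx (M *m e k)
      + (theta * dt) *: usubmx (M *m e k.+1) + usubmx (d k.+1).
    by rewrite {1}(eS k kN) !linearD !linearZ.
  rewrite !Af /f zS// {1}(yS k kN) {}eL /g.
  move: (usubmx (M *m e k)) (usubmx (M *m e k.+1)) (usubmx (e k)) (usubmx (d _)) => v1 v2 v3 v4.
  by apply/matrixP => i j; rewrite !mxE; ring.
have f0 : f 0%N = 0 by rewrite /f e0 y0 /z E0 y0 subrr !scale0r linear0 !subr0.
have gb k : (k < N)%N -> `|g k.+1| <= a + b1 + b2.
  move=> kN; have [da db1 db2] := db k kN.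
  apply: le_trans (ler_normB _ _) _; apply: lerD.
    apply: le_trans (ler_normB _ _) _; apply: lerD => //.
    by rewrite normrZ -[b1]mulr1 ler_pM.
  rewrite normrZ -[b2]mulr1 ler_pM//; apply: le_trans db2; exact: c_bnd.
have A00 i : log_row A i <= 0 by apply: le_trans (A0 i) _; lra.
have th0 : 0 <= theta by lra.
have fb := theta_recursion_norm m0 th0 dt0 A00 phiK f0 fS gb nN.
have yb := ybnd n nN; have zb := zbnd _ n nN.
have n0 : 0 <= n%:R * b1 by exact: le_trans (normr_ge0 _) yb.
have n2 : 0 <= n%:R * b2 by exact: le_trans (normr_ge0 _) (zb 0).
(* The sign of [a] is known only through [db], hence only when there is at least one step. *)
have na : 0 <= n%:R * a.
  case: n nN {fb yb zb n0 n2} => [|n] nN; first by rewrite mul0r.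
  by rewrite mulr_ge0//; have [da _ _] := db 0%N (leq_ltn_trans (leq0n n) nN); apply: le_trans da.
have tgt0 : n%:R * (b1 + b2) <= n%:R * (K * a + (K + 1) * (b1 + b2)).
  have : 0 <= (n%:R * a) * K by rewrite mulr_ge0//; lra.
  have : 0 <= (n%:R * b1 + n%:R * b2) * K by rewrite mulr_ge0 ?addr_ge0//; lra.
  lra.
apply: cV_norm_le => [|i]; first by apply: le_trans tgt0; rewrite mulrDr addr_ge0.
rewrite -[e n]vsubmxK mxE; case: split_ordP => k _ /=.
  (* [f] contributes [K * (a + b1 + b2)] per step, and [p], [q] add [b1 + b2]; this is the origin of
     [K + 1]. *)
  have -> : usubmx (e n) = f n + y n *: p + z 0 n *: q.
    by rewrite /f addrAC !subrK.
  apply: le_trans (cV_norm_ge _ k) _.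
  apply: le_trans (ler_normD _ _) _; rewrite normrZ.
  apply: le_trans (lerD (ler_normD _ _) (lexx _)) _; rewrite normrZ.
  have := ler_pM (normr_ge0 _) (normr_ge0 _) yb p1.
  have := ler_pM (normr_ge0 _) (normr_ge0 _) (zb 0) q1.
  rewrite !mulr1; move: fb; lra.
apply: le_trans tgt0; rewrite -/(E k n) -[E k n](subrK (y n)) -/(z k n) mulrDr [leRHS]addrC.
by apply: le_trans (ler_normD _ _) _; exact: lerD.
Qed.

(** * Truncation error of the semidiscrete system *)

Lemma truncation_errorE (R : realType) (m : nat) (S T : R) (s : nat -> R)
    (u : R -> R -> R) (k : nat) (M : 'M[R]_(m + 2)) (b : R -> 'cV[R]_(m + 2)) (t : R) :
  Ck_rectangle S T k.+1 u -> 0 < T -> 0 <= t <= T ->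
  (forall i : 'I_(m + 2), 0 <= s i.+1 <= S) ->
  truncation_error T s u M b t =
  grid_values m s (partial_on S T [:: InTime] u) t - M *m grid_values m s u t - b t.
Proof.
move=> uk T0 tT sS; rewrite /truncation_error.
suff [_ ->] : derivable_on 0 T (grid_values m s u) t /\
  deriv_on 0 T (grid_values m s u) t = grid_values m s (partial_on S T [:: InTime] u) t by [].
apply: deriv_onP; rewrite ?in_itv//.
apply: col_diffquot_on => i.
have := @Ck_has_deriv_time R S T k.+1 u [::] (s i.+1) uk isT (sS i) t.
rewrite in_itv /= mxE => /(_ tT).
rewrite /diffquot_on (_ : (fun y => _) = fun y =>
  (y - t)^-1 *: (grid_values m s u y i 0 - grid_values m s u t i 0))//.
by apply/funext => y; rewrite !mxE.
Qed.

(** The equation is assumed for [t > 0] only, but the first step of the theta-method involves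
    [t = 0]; continuity of both sides in time extends it. *)
Lemma black_scholes_closed (R : realType) (r sigma S T : R) (u0 g : R -> R)
    (u : R -> R -> R) (s t : R) :
  Ck_rectangle S T 2 u -> 0 < T -> black_scholes r sigma S T u0 g u ->
  0 < s <= S -> 0 <= t <= T ->
  partial_on S T [:: InTime] u s t =
    2^-1 * sigma ^+ 2 * s ^+ 2 * partial_on S T [:: InSpace; InSpace] u s t
    + r * s * partial_on S T [:: InSpace] u s t - r * u s t.
Proof.
move=> uk T0 [pde _ _ _] sS; have sS' : 0 <= s <= S by case/andP: sS => /ltW ->.
case/andP; rewrite le_eqVlt => /predU1P[<- _|t0 tT]; last by apply: pde; rewrite ?t0.
apply/eqP; rewrite -subr_eq0; apply/eqP.
pose f w := partial_on S T w u s.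
apply: (continuous_eq0_left (f := fun t => f [:: InTime] t -
  (2^-1 * sigma ^+ 2 * s ^+ 2 * f [:: InSpace; InSpace] t + r * s * f [:: InSpace] t
   - r * f [::] t)) T0).
  have cf w : (size w <= 2)%N -> {within `[0, T], continuous (f w)}.
    by move=> w2; exact: Ck_continuous_time uk w2 sS'.
  move=> x; apply: cvgB; first exact: cf.
  apply: cvgB; last by apply: cvgM; [exact: cvg_cst|exact: cf].
  by apply: cvgD; apply: cvgM; [exact: cvg_cst|exact: cf|exact: cvg_cst|exact: cf].
by move=> x xT /=; rewrite /f -pde// subrr.
Qed.

Lemma linear_boundary_closed (R : realType) (r sigma S T : R) (u0 g : R -> R)
    (u : R -> R -> R) (t : R) :
  Ck_rectangle S T 2 u -> 0 <= S -> 0 < T -> black_scholes r sigma S T u0 g u ->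
  0 <= t <= T -> partial_on S T [:: InSpace; InSpace] u S t = 0.
Proof.
move=> uk S0 T0 [_ _ _ lin].
case/andP; rewrite le_eqVlt => /predU1P[<- _|t0 tT]; last by apply: lin; rewrite ?t0.
apply: (continuous_eq0_left T0) => //.
by apply: Ck_continuous_time uk _ _; rewrite ?S0//=.
Qed.

Lemma grid_lt (R : realType) (m : nat) (S : R) (s : nat -> R) (i j : nat) :
  is_grid m S s -> (i < j)%N -> (j <= m + 2)%N -> s i < s j.
Proof.
move=> [_ _ sS]; elim: j => // j IH; rewrite ltnS leq_eqVlt => /predU1P[->|ij] jm.
  by apply: sS; lia.
by apply: lt_trans (IH ij _) (sS j _); lia.
Qed.

Lemma grid_range (R : realType) (m : nat) (S : R) (s : nat -> R) (i : 'I_(m + 2)) :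
  is_grid m S s -> 0 <= s i.+1 <= S.
Proof.
move=> gs; have [s0 sS _] := gs; apply/andP; split.
  by rewrite -s0 ltW//; exact: grid_lt gs _ (ltn_ord i).
have := ltn_ord i; rewrite leq_eqVlt => /predU1P[->|im]; first by rewrite sS.
by rewrite -sS ltW//; exact: grid_lt gs im (leqnn _).
Qed.

Lemma grid_penultimate (R : realType) (m : nat) (S : R) (s : nat -> R) :
  is_grid m S s -> 0 < s m.+1 < S.
Proof.
move=> gs; have [s0 sS _] := gs.
by rewrite -{1}s0 -sS !(grid_lt gs)// addn2.
Qed.

(** The equation replaces [u_t] at the last two grid points, and [u_ss(S) = 0] removes the diffusion
    term at [S]; the rest is [boundary_truncation]. *)
Lemma boundary_truncation_error (R : realType) (r sigma S T hstar : R) (u0 g : R -> R)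
    (u : R -> R -> R) (m : nat) (s alpha beta gamma : nat -> R)
    (b : R -> 'cV[R]_(m + 2)) (t : R)
    (v := dsubmx (truncation_error T s u (mxM m r S s alpha beta gamma) b t))
    (bound := (2^-1 * sigma ^+ 2 * S ^+ 3 + 2 * r * S ^+ 2 * hstar) * bs_eta S T hstar u t) :
  Ck_rectangle S T 3 u -> 0 < T -> 0 < r -> black_scholes r sigma S T u0 g u ->
  (2 <= m)%N -> is_grid m S s ->
  (forall (t : R) (i : 'I_(m + 2)), 0 <= t <= T -> (0 < i)%N -> b t i 0 = 0) ->
  mesh_width s (m + 2) <= hstar -> 0 <= t <= T ->
  `|boundary_mean S (s m.+1) v| <= bound /\ `|boundary_slope S (s m.+1) v| <= bound.
Proof.
move=> u3 T0 r0 bs m2 gs b0 hh tT.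
have u2 : Ck_rectangle S T 2 u by apply: Ck_rectangle_le u3.
have [_ sS _] := gs; have /andP[s0 ltS] := grid_penultimate gs.
have S0 : 0 < S by lra.
have hE : mesh_width s (m + 2) = S - s m.+1 by rewrite /mesh_width sS addn2.
have gridS i := grid_range i gs.
pose E := bs_eta S T hstar u t.
have [M3 M3P] := Ck_bounded (w := [:: InSpace; InSpace; InSpace]) u3 isT.
(* [[s m.+1, S]] lies inside the range of the maximum in [bs_eta] because the last mesh width is at
   most [hstar]. *)
have fE z : s m.+1 <= z <= S -> `|partial_on S T [:: InSpace; InSpace; InSpace] u z t| <= E.
  move=> /andP[sz zS].
  pose f xi := `|partial_on S T [:: InSpace; InSpace; InSpace] u xi t|.
  rewrite /E /bs_eta; apply: (max_over_ge (f := f) (M := M3)).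
    move=> x; rewrite /= in_itv/= ge_max => /andP[/andP[x0 _] xS].
    by apply: M3P => //; rewrite x0.
  by rewrite /= in_itv/= ge_max zS andbT; apply/andP; split; lra.
have dx w : (size w < 3)%N ->
    has_deriv_on 0 S (partial_on S T w u ^~ t) (partial_on S T (InSpace :: w) u ^~ t).
  by move=> w3; exact: Ck_has_deriv_space u3 w3 tT.
have linS := linear_boundary_closed u2 (ltW S0) T0 bs tT.
have [e2 e1s e1S] := linear_boundary_estimates (dx [::] isT) (dx [:: InSpace] isT)
  (dx [:: InSpace; InSpace] isT) linS s0 ltS fE.
have [H1 H2] := boundary_truncation sigma s0 ltS (ltW r0) e2 e1s e1S.
have E0 : 0 <= E by apply: le_trans (normr_ge0 _) (fE S _); rewrite lexx ltW.
(* The 0-based row [m + i] belongs to the grid point [s (m.+1 + i)]; it is not the first row, so [b]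
   vanishes there. *)
have vE (i : 'I_2) : v i 0 = partial_on S T [:: InTime] u (s (m.+1 + i)%N) t
    - r / (S - s m.+1) * (- S * u (s m.+1) t + s m.+1 * u S t).
  have bi : b t (rshift m i) 0 = 0 by apply: b0 => //=; rewrite addn_gt0 (ltnW m2).
  have dE (x : 'cV[R]_(m + 2)) k : dsubmx x k 0 = x (rshift m k) 0 by rewrite mxE.
  have subE (x y : 'cV[R]_(m + 2)) k : (x - y) k 0 = x k 0 - y k 0 by rewrite !mxE.
  have gvE w k : grid_values m s w t k 0 = w (s k.+1) t by rewrite mxE.
  rewrite /v dE (truncation_errorE _ _ u3 T0 tT gridS) !subE bi subr0.
  rewrite -(dE (mxM _ _ _ _ _ _ _ *m _)) dsubmx_mxM hE !dE !gvE.
  have sS2 : s m.+2 = S by rewrite -sS addn2.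
  by rewrite /= addn0 addn1 sS2 addSn.
have v0 : v 0 0 = 2^-1 * sigma ^+ 2 * s m.+1 ^+ 2 * partial_on S T [:: InSpace; InSpace] u (s m.+1) t
    + r * s m.+1 * partial_on S T [:: InSpace] u (s m.+1) t - r * u (s m.+1) t
    - r / (S - s m.+1) * (- S * u (s m.+1) t + s m.+1 * u S t).
  by rewrite vE addn0 (black_scholes_closed u2 T0 bs _ tT)// s0 ltW.
have v1 : v 1 0 = r * S * partial_on S T [:: InSpace] u S t - r * u S t
    - r / (S - s m.+1) * (- S * u (s m.+1) t + s m.+1 * u S t).
  rewrite vE addn1 -[in m.+2]addn2 sS (black_scholes_closed u2 T0 bs _ tT) ?S0 ?lexx//.
  by rewrite linS mulr0 add0r.
have bnd : (2^-1 * sigma ^+ 2 * S ^+ 3 + 2 * r * S ^+ 2 * (S - s m.+1)) * E <= bound.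
  rewrite /bound -/E ler_wpM2r// lerD2l ler_wpM2l -?hE//.
  by rewrite mulr_ge0 ?sqr_ge0// mulr_ge0// ltW.
by rewrite /boundary_mean /boundary_slope v0 v1; split; apply: le_trans bnd.
Qed.

(** Only finiteness matters: it guarantees that the maximum of the interior truncation error is a
    genuine supremum. *)
Lemma truncation_error_bounded (R : realType) (m : nat) (S T : R) (s : nat -> R)
    (u : R -> R -> R) (k : nat) (M : 'M[R]_(m + 2)) (b : R -> 'cV[R]_(m + 2)) :
  Ck_rectangle S T k.+1 u -> 0 < T -> (forall i : 'I_(m + 2), 0 <= s i.+1 <= S) ->
  {within `[0, T], continuous b} ->
  exists B, forall t, 0 <= t <= T -> `|truncation_error T s u M b t| <= B.
Proof.
move=> uk T0 sS cb.
have [B0 B0P] := Ck_bounded (w := [::]) uk isT.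
have [B1 B1P] := Ck_bounded (w := [:: InTime]) uk isT.
have [B2 B2P] := continuous_on_bounded cb.
exists (`|B1| + opnorm M * `|B0| + B2) => t tT.
rewrite (truncation_errorE _ _ uk T0 tT sS).
apply: le_trans (ler_normB _ _) _; apply: lerD; last exact: B2P.
apply: le_trans (ler_normB _ _) _; apply: lerD.
  apply: cV_norm_le => // i; rewrite mxE (le_trans _ (ler_norm _))//.
  exact: (B1P _ _ (sS i) tT).
apply: le_trans (norm_mulmx_le_opnorm _ _) _; rewrite ler_wpM2l ?opnorm_ge0//.
apply: cV_norm_le => // i; rewrite mxE (le_trans _ (ler_norm _))//.
exact: (B0P _ _ (sS i) tT).
Qed.

(** * Time quadrature and the error recursion *)

Definition quadrature_defect (R : realType) (S T theta t0 t1 : R) (u : R -> R -> R) (s : R) : R :=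
  u s t1 - u s t0 - (t1 - t0) * ((1 - theta) * partial_on S T [:: InTime] u s t0
                                 + theta * partial_on S T [:: InTime] u s t1).

(** The second bound applies the quadrature estimate to [u S - u s], whose time derivatives are
    [O(S - s)] by the mean value theorem in space. This gain offsets the division by [S - s] and
    uses [p + 1] time derivatives and one space derivative. *)
Lemma quadrature_defect_bounds (R : realType) (S T theta : R) (u : R -> R -> R) :
  2^-1 <= theta <= 1 -> Ck_rectangle S T (method_order theta + 2) u ->
  exists D1 D2 : R, [/\ 0 <= D1, 0 <= D2 &
    forall t0 t1 s, 0 <= t0 -> t0 < t1 -> t1 <= T -> 0 <= s <= S ->
      `|quadrature_defect S T theta t0 t1 u s| <= D1 * (t1 - t0) ^+ (method_order theta).+1 /\
      `|quadrature_defect S T theta t0 t1 u S - quadrature_defect S T theta t0 t1 u s|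
         <= D2 * (S - s) * (t1 - t0) ^+ (method_order theta).+1].
Proof.
move=> th uk; set p := method_order theta in uk *.
pose w k := nseq k InTime.
have [D1 D1P] := Ck_bounded (w := w p.+1) uk (ltac:(rewrite size_nseq addn2; exact: leqnSn)).
have [D2 D2P] := Ck_bounded (w := InSpace :: w p.+1) uk
  (ltac:(by rewrite /= size_nseq addn2)).
exists (2 * `|D1|), (2 * `|D2|); split; rewrite ?mulr_ge0//.
move=> t0 t1 s t00 t01 t1T sS; have [s0 sS'] := andP sS.
have tT t : t0 <= t <= t1 -> 0 <= t <= T.
  by move=> /andP[? ?]; apply/andP; split; lra.
have dt k x : (k <= p)%N -> 0 <= x <= S ->
    has_deriv_on 0 T (partial_on S T (w k) u x) (partial_on S T (w k.+1) u x).
  by move=> kp xS; apply: Ck_has_deriv_time uk _ xS; rewrite size_nseq; lia.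
have SS : 0 <= S <= S by apply/andP; split; lra.
split.
  apply: (theta_quadrature (g := fun k => partial_on S T (w k) u s) th _ t00 t01 t1T).
    by move=> k kp; exact: dt.
  by move=> z zt; apply: le_trans (ler_norm _); apply: D1P => //; exact: tT.
have -> : quadrature_defect S T theta t0 t1 u S - quadrature_defect S T theta t0 t1 u s =
    (u S t1 - u s t1) - (u S t0 - u s t0) - (t1 - t0) *
    ((1 - theta) * (partial_on S T [:: InTime] u S t0 - partial_on S T [:: InTime] u s t0)
     + theta * (partial_on S T [:: InTime] u S t1 - partial_on S T [:: InTime] u s t1)).
  by rewrite /quadrature_defect; ring.
rewrite -(mulrA 2).
apply: (theta_quadrature (g := fun k t => partial_on S T (w k) u S t - partial_on S T (w k) u s t)
  th _ t00 t01 t1T).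
  by move=> k kp; apply: has_deriv_onB; exact: dt.
move=> z zt.
apply: (mean_value_dist (Ck_has_deriv_space (w := w p.+1) uk _ (tT z zt))) => //.
  by rewrite size_nseq addn2.
move=> x /andP[sx xS]; apply: le_trans (ler_norm _).
by apply: D2P (tT z zt); apply/andP; split; lra.
Qed.

Lemma bs_eta_bounded (R : realType) (S T hstar : R) (u : R -> R -> R) :
  Ck_rectangle S T 3 u -> 0 < S -> 0 < hstar ->
  exists B, forall t, 0 <= t <= T -> 0 <= bs_eta S T hstar u t <= B.
Proof.
move=> u3 S0 h0; have [B BP] := Ck_bounded (w := [:: InSpace; InSpace; InSpace]) u3 isT.
exists B => t tT.
pose f xi := `|partial_on S T [:: InSpace; InSpace; InSpace] u xi t|.
have fB x : x \in `[Num.max 0 (S - hstar), S] -> f x <= B.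
  rewrite in_itv/= ge_max => /andP[/andP[x0 _] xS].
  by apply: BP => //; rewrite x0.
have SS : S \in `[Num.max 0 (S - hstar), S].
  by rewrite in_itv/= ge_max lexx andbT; apply/andP; split; lra.
apply/andP; split; last exact: (max_over_le (A := `[Num.max 0 (S - hstar), S]) (f := f) SS fB).
by apply: le_trans (max_over_ge (A := `[Num.max 0 (S - hstar), S]) (f := f) fB SS); exact: normr_ge0.
Qed.

Lemma norm_add_convex_le (R : realType) (V : normedModType R) (theta dt B : R) (x y0 y1 : V) :
  0 <= theta <= 1 -> 0 <= dt -> `|y0| <= B -> `|y1| <= B ->
  `|x + ((1 - theta) * dt) *: y0 + (theta * dt) *: y1| <= `|x| + dt * B.
Proof.
move=> /andP[th0 th1] dt0 y0B y1B.
have a0 : 0 <= (1 - theta) * dt by rewrite mulr_ge0//; lra.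
have a1 : 0 <= theta * dt by rewrite mulr_ge0.
rewrite -addrA; apply: le_trans (ler_normD _ _) _; rewrite lerD2l.
apply: le_trans (ler_normD _ _) _; rewrite (normrZ _ y0) (normrZ _ y1) (ger0_norm a0) (ger0_norm a1).
have -> : dt * B = (1 - theta) * dt * B + theta * dt * B by ring.
by apply: lerD; rewrite ler_wpM2l.
Qed.

Lemma method_order_gt0 (R : realType) (theta : R) : (0 < method_order theta)%N.
Proof. by rewrite /method_order; case: ifP. Qed.

(** The exact values satisfy the scheme up to the defect once their time derivative is written as
    [M u_h + b + delta]; subtracting the scheme cancels [b]. *)
Lemma theta_method_error (R : realType) (m N : nat) (S T theta dt : R) (s : nat -> R)
    (u : R -> R -> R) (M : 'M[R]_(m + 2)) (b : R -> 'cV[R]_(m + 2))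
    (U : nat -> 'cV[R]_(m + 2)) (k : nat) :
  Ck_rectangle S T k.+1 u -> 0 < T -> (forall i : 'I_(m + 2), 0 <= s i.+1 <= S) ->
  theta_method theta dt N M b (grid_values m s u 0) U ->
  let t (n : nat) := n%:R * dt in
  let e n := grid_values m s u (t n) - U n in
  let delta := truncation_error T s u M b in
  forall n, (n < N)%N -> 0 <= t n -> t n.+1 <= T -> 0 <= dt ->
    e n.+1 = e n + ((1 - theta) * dt) *: (M *m e n) + (theta * dt) *: (M *m e n.+1)
      + (\col_i quadrature_defect S T theta (t n) (t n.+1) u (s i.+1)
         + ((1 - theta) * dt) *: delta (t n) + (theta * dt) *: delta (t n.+1)).
Proof.
move=> uk T0 sS [_ US] t e delta n nN tn0 tnT dt0.
have tS : t n.+1 = t n + dt by rewrite /t -natr1; ring.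
have tnT' : 0 <= t n <= T by apply/andP; split; lra.
have tST : 0 <= t n.+1 <= T by apply/andP; split; lra.
rewrite /delta !(truncation_errorE _ _ uk T0 _ sS)//.
rewrite {1}/e {1}(US n.+1 nN) /= -/(t n) -/(t n.+1).
set u0 := grid_values m s u (t n); set u1 := grid_values m s u (t n.+1).
have Me k' : M *m e k' = M *m grid_values m s u (t k') - M *m U k' by rewrite mulmxBr.
rewrite !Me -/u0 -/u1 {1}/e -/u0.
move: (M *m u0) (M *m u1) (M *m U n) (M *m U n.+1) (b (t n)) (b (t n.+1)) => v0 v1 w0 w1 b0 b1.
apply/matrixP => i j; rewrite !mxE /quadrature_defect tS /=; ring.
Qed.

Lemma usubmx_comb (R : realType) (m n : nat) (x y z : 'cV[R]_(m + n)) (a c : R) :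
  usubmx (x + a *: y + c *: z) = usubmx x + a *: usubmx y + c *: usubmx z.
Proof. by apply/matrixP => i j; rewrite !mxE. Qed.

Lemma dsubmx_comb (R : realType) (m n : nat) (x y z : 'cV[R]_(m + n)) (a c : R) :
  dsubmx (x + a *: y + c *: z) = dsubmx x + a *: dsubmx y + c *: dsubmx z.
Proof. by apply/matrixP => i j; rewrite !mxE. Qed.

Lemma boundary_mean_comb (R : realType) (S s a c : R) (x y z : 'cV[R]_2) :
  boundary_mean S s (x + a *: y + c *: z) =
  boundary_mean S s x + a *: boundary_mean S s y + c *: boundary_mean S s z.
Proof. by rewrite /boundary_mean !mxE /GRing.scale /=; ring. Qed.

Lemma boundary_slope_comb (R : realType) (S s a c : R) (x y z : 'cV[R]_2) :
  boundary_slope S s (x + a *: y + c *: z) =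
  boundary_slope S s x + a *: boundary_slope S s y + c *: boundary_slope S s z.
Proof. by rewrite /boundary_slope !mxE /GRing.scale /=; ring. Qed.

(** * Collecting the estimates with a uniform constant *)

Theorem theorem6 (R : realType) (S T : R) (u : R -> R -> R) (theta K : R)
    (S_gt0 : 0 < S) (T_gt0 : 0 < T) (theta_itv : 2^-1 <= theta <= 1)
    (u_smooth : Ck_rectangle S T (method_order theta + 2) u) :
  exists c : R,
  forall (r sigma hstar : R) (u0 g : R -> R),
    0 < r -> 0 <= sigma -> 0 < hstar ->
    black_scholes r sigma S T u0 g u ->
  forall (m : nat) (s alpha beta gamma : nat -> R)
      (b : R -> 'cV[R]_(m + 2)),
    (2 <= m)%N ->
    is_grid m S s ->
    {within `[0, T], continuous b} ->
    (forall (t : R) (i : 'I_(m + 2)), 0 <= t <= T -> (0 < i)%N -> b t i 0 = 0) ->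
    let A := mxA m alpha beta gamma in
    let M := mxM m r S s alpha beta gamma in
    let uh := grid_values m s u in
    let deltaL := fun t : R => usubmx (truncation_error T s u M b t) in
    r%:M + A \in unitmx ->
    lognorm (r%:M + A) <= 0 ->
    r + alpha m + `|beta m| + `|gamma m| <= 0 ->
    (forall N n : nat, (1 <= N)%N -> (n <= N)%N ->
       opnorm (theta_phi theta ((T / N%:R) *: A) ^+ n) <= K) ->
    0 < mesh_width s (m + 2) <= hstar ->
  forall (N n : nat) (U : nat -> 'cV[R]_(m + 2)),
    (1 <= N)%N -> (1 <= n <= N)%N ->
    let dt := T / N%:R in
    let tn := n%:R * dt in
    theta_method theta dt N M b (uh 0) U ->
    `|uh tn - U n| <=
      tn * (K * max_over `[0, tn] (fun v => `|deltaL v|)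
            + (K + 2^-1) * bs_kappa r sigma S hstar
                * max_over `[0, tn] (bs_eta S T hstar u)
            + c * dt ^+ method_order theta).
Proof.
have [D1 [D2 [D10 D20 defect]]] := quadrature_defect_bounds theta_itv u_smooth.
(* [D1] bounds the interior defect, and [D1 + 2 * S * D2] sums the bounds for its boundary mean and
   slope. Both constants are fixed before the coefficients and the grid. *)
exists (K * D1 + (K + 1) * (D1 + 2 * S * D2)) => r sigma hstar u0 g r0 sg0 hs0 bs.
move=> m s al be ga b m2 gs cb b0 A M uh deltaL rAu lgn last phiK /andP[_ hmh].
move=> N n U N1 /andP[n1 nN] dt tn HU.
have dt0 : 0 < dt by rewrite divr_gt0// ltr0n.
have [_ sS _] := gs; have /andP[s0 ltS] := grid_penultimate gs.
have K1 : 1 <= K.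
  by have := phiK N 0%N N1 (leq0n N); rewrite expr0 opnorm1 ?(ltnW m2).
have th1 : 2^-1 <= theta by case/andP: theta_itv.
have rowA i : log_row (r%:M + A) i <= 0 := le_trans (log_row_le_lognorm _ i) lgn.
(* The horizon is [n] rather than [N], so that only local errors on [[0, tn]] enter. *)
have stab a b1 b2 e d := error_stability (a := a) (b1 := b1) (b2 := b2) (e := e) (d := d)
  m2 th1 (ltW dt0) r0 sS s0 ltS rAu rowA last (fun k kn => phiK N k N1 (leq_trans kn nN)).
clear rAu lgn rowA last phiK.
set p := method_order theta in u_smooth defect *.
have p1 : (0 < p)%N by exact: method_order_gt0.
have u3 : Ck_rectangle S T 3 u by apply: Ck_rectangle_le u_smooth; rewrite addn2.
have gridS i := grid_range i gs.
pose t (k : nat) := k%:R * dt.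
have t0 k : 0 <= t k by rewrite mulr_ge0// ltW.
have tk k : (k <= n)%N -> 0 <= t k <= tn.
  by move=> kn; rewrite t0/= ler_pM2r// ler_nat.
have tnT : tn <= T.
  by rewrite /tn /dt mulrCA ler_piMr ?(ltW T_gt0)// ler_pdivrMr ?ltr0n// mul1r ler_nat.
have tnT' v : 0 <= v <= tn -> 0 <= v <= T.
  by move=> /andP[-> /le_trans]; exact.
have ttT k : (k <= n)%N -> 0 <= t k <= T by move=> kn; exact/tnT'/tk.
pose delta := truncation_error T s u M b.
pose ML := max_over `[0, tn] (fun v => `|deltaL v|).
pose He := max_over `[0, tn] (bs_eta S T hstar u).
have deltaL_le k : (k <= n)%N -> `|usubmx (delta (t k))| <= ML.
  move=> kn; have [B BP] := truncation_error_bounded M u3 T_gt0 gridS cb.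
  apply: (max_over_ge (A := `[0, tn]) (f := fun v => `|deltaL v|) (M := B)); last first.
    by rewrite /= in_itv/= tk.
  move=> v; rewrite /= in_itv/= => vt; apply: le_trans (BP v (tnT' v vt)).
  by apply: cV_norm_le => // i; rewrite mxE cV_norm_ge.
have [B etaB] := bs_eta_bounded u3 S_gt0 hs0.
have eta_le k : (k <= n)%N -> bs_eta S T hstar u (t k) <= He.
  move=> kn; apply: (max_over_ge (A := `[0, tn]) (f := bs_eta S T hstar u) (M := B)).
    by move=> v; rewrite /= in_itv/= => vt; have /andP[] := etaB v (tnT' v vt).
  by rewrite /= in_itv/= tk.
have He0 : 0 <= He.
  by apply: le_trans (eta_le 0%N (leq0n _)); have /andP[] := etaB _ (ttT 0%N (leq0n _)).
pose kap := 2^-1 * sigma ^+ 2 * S ^+ 3 + 2 * r * S ^+ 2 * hstar.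
have sig0 : 0 <= sigma ^+ 2 * S ^+ 3 by rewrite mulr_ge0 ?sqr_ge0// exprn_ge0// ltW.
have rS0 : 0 <= r * S ^+ 2 * hstar.
  by rewrite mulr_ge0 ?(ltW hs0)// mulr_ge0 ?sqr_ge0// ltW.
have kap0 : 0 <= kap by rewrite /kap; lra.
have deltaR k : (k <= n)%N ->
    `|boundary_mean S (s m.+1) (dsubmx (delta (t k)))| <= kap * He /\
    `|boundary_slope S (s m.+1) (dsubmx (delta (t k)))| <= kap * He.
  move=> kn; have [H1 H2] := boundary_truncation_error al be ga u3 T_gt0 r0 bs m2 gs b0 hmh (ttT k kn).
  have le1 : kap * bs_eta S T hstar u (t k) <= kap * He by rewrite ler_wpM2l// eta_le.
  by split; [exact: le_trans H1 le1|exact: le_trans H2 le1].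
(* Index [k] labels the step from [t k.-1] to [t k]; only [k >= 1] occurs in the recursion. *)
pose rho k : 'cV[R]_(m + 2) :=
  \col_i quadrature_defect S T theta (t k.-1) (t k) u (s i.+1).
pose d k := rho k + ((1 - theta) * dt) *: delta (t k.-1) + (theta * dt) *: delta (t k).
pose e k := uh (t k) - U k.
have U0 : U 0%N = uh 0 by case: HU.
have e0 : e 0%N = 0 by rewrite /e /t mul0r U0 subrr.
have eS k : (k < n)%N ->
    e k.+1 = e k + ((1 - theta) * dt) *: (M *m e k) + (theta * dt) *: (M *m e k.+1) + d k.+1.
  move=> kn; apply: (theta_method_error u3 T_gt0 gridS HU (leq_trans kn nN) (t0 k) _ (ltW dt0)).
  by have /andP[] := ttT k.+1 kn.
have th01 : 0 <= theta <= 1 by move/andP: theta_itv => [? ->]; rewrite andbT; lra.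
pose P := dt ^+ p.+1.
have tS k : t k.+1 - t k = dt by rewrite /t -natr1; ring.
have rhoB k x : (k < n)%N -> 0 <= x <= S ->
    `|quadrature_defect S T theta (t k) (t k.+1) u x| <= D1 * P /\
    `|quadrature_defect S T theta (t k) (t k.+1) u S - quadrature_defect S T theta (t k) (t k.+1) u x|
      <= D2 * (S - x) * P.
  move=> kn xS; rewrite /P -(tS k); apply: defect => //.
    by rewrite -subr_gt0 tS.
  by have /andP[] := ttT k.+1 kn.
have h0 : 0 < S - s m.+1 by rewrite subr_gt0.
have slopeB k : (k < n)%N -> `|boundary_slope S (s m.+1) (dsubmx (rho k.+1))| <= S * D2 * P.
  move=> kn; rewrite /boundary_slope !mxE /=.
  have -> : s (m + 1)%N.+1 = S by rewrite -addnS.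
  rewrite addn0; have [_] := rhoB k (s m.+1) kn (ltac:(by rewrite !ltW)).
  move: (_ - _) => x xB.
  rewrite !normrM (gtr0_norm S_gt0) normfV (gtr0_norm h0).
  rewrite ler_pdivrMr// -!mulrA ler_pM2l//.
  by apply: le_trans xB _; rewrite mulrAC -mulrA.
have meanB k : (k < n)%N -> `|boundary_mean S (s m.+1) (dsubmx (rho k.+1))| <= (D1 + S * D2) * P.
  move=> kn.
  (* Rewriting the mean as the first entry minus [s / S] times the slope hides the division by
     [S - s] in a slope that is already bounded. *)
  have -> : boundary_mean S (s m.+1) (dsubmx (rho k.+1)) =
      rho k.+1 (rshift m 0) 0 - s m.+1 / S * boundary_slope S (s m.+1) (dsubmx (rho k.+1)).
    rewrite /boundary_mean /boundary_slope [dsubmx _ 0 0]mxE [dsubmx _ 1 0]mxE.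
    by field; rewrite !gt_eqF ?subr_gt0.
  rewrite mulrDl; apply: le_trans (ler_normB _ _) _; apply: lerD.
    by rewrite mxE; apply: (rhoB k _ kn _).1.
  rewrite normrM; apply: le_trans (slopeB k kn).
  by rewrite ler_piMl// ger0_norm ?divr_ge0 ?(ltW s0) ?(ltW S_gt0)// ler_pdivrMr// mul1r ltW.
have dB k : (k < n)%N ->
    [/\ `|usubmx (d k.+1)| <= D1 * P + dt * ML,
        `|boundary_mean S (s m.+1) (dsubmx (d k.+1))| <= (D1 + S * D2) * P + dt * (kap * He)
      & `|boundary_slope S (s m.+1) (dsubmx (d k.+1))| <= S * D2 * P + dt * (kap * He)].
  move=> kn; have kn' := ltnW kn; have [m0 sl0] := deltaR k kn'; have [m1 sl1] := deltaR k.+1 kn.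
  split.
  - rewrite /d usubmx_comb.
    apply: le_trans (norm_add_convex_le _ th01 (ltW dt0) (deltaL_le k kn') (deltaL_le k.+1 kn)) _.
    rewrite lerD2r; apply: cV_norm_le => [|i].
      by rewrite mulr_ge0// exprn_ge0// ltW.
    by rewrite !mxE; exact: (rhoB k _ kn (gridS _)).1.
  - rewrite /d dsubmx_comb boundary_mean_comb.
    apply: le_trans (norm_add_convex_le _ th01 (ltW dt0) m0 m1) _.
    by rewrite lerD2r meanB.
  - rewrite /d dsubmx_comb boundary_slope_comb.
    apply: le_trans (norm_add_convex_le _ th01 (ltW dt0) sl0 sl1) _.
    by rewrite lerD2r slopeB.
have := stab _ _ _ _ _ e0 eS dB n (leqnn n).
move=> /le_trans; apply; rewrite -/ML -/He /tn -[leRHS]mulrA ler_wpM2l//.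
clear - K1 dt0 He0 sig0 rS0; rewrite /P /kap /bs_kappa exprS.
(* Mean and slope each contribute [kap * He], and [2 * kap] is [sigma ^+ 2 * S ^+ 3 + 4 * (r * S ^+
   2 * hstar)]. *)
rewrite [leLHS](_ : _ = dt * (K * ML + (K + 1) * (sigma ^+ 2 * S ^+ 3 + 4 * (r * S ^+ 2 * hstar)) * He
  + (K * D1 + (K + 1) * (D1 + 2 * S * D2)) * dt ^+ p)); last by field.
rewrite ler_wpM2l ?(ltW dt0)// lerD2r lerD2l ler_wpM2r//.
move: sig0 rS0; set x := sigma ^+ 2 * S ^+ 3; set y := r * _ * hstar => x0 y0.
have -> : 4 * sigma ^+ 2 * S ^+ 3 + 6 * r * S ^+ 2 * hstar = 4 * x + 6 * y by rewrite /x /y; ring.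
(* [(K + 1/2) * (4 * x + 6 * y)] exceeds [(K + 1) * (x + 4 * y)] by
   [(3 * K + 1) * x + (2 * K - 1) * y], which is nonnegative as [K >= 1]. *)
have : 0 <= (3 * K + 1) * x by rewrite mulr_ge0//; lra.
have : 0 <= (2 * K - 1) * y by rewrite mulr_ge0//; lra.
lra.
Qed.
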